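(* Let $1\leq\alpha<2$ and let $S_\alpha$ be the $\alpha$-stable random walk on $\mathbb{Z}^2$. Let $\mathcal{A}\subset\mathbb{Z}^2$ be a radially bounded superlinear set. Then $\mathcal{A}$ is $S_\alpha$-massive if and only if $$\sum_{a\in\mathcal{A}}\frac{1}{\Vert a\Vert_\infty^{2-\alpha}}=\infty.$$
   Context: Let $S$ be the symmetric simple random walk on $\mathbb{Z}^2$, with transition operator $P$. For $0<\alpha<2$, the $\alpha$-stable random walk $S_\alpha$ is the (transient) random walk on $\mathbb{Z}^2$ with transition operator $P_\alpha=I-(I-P)^{\alpha/2}=\sum_{k\geq1}c_kP^k$, where $c_k=(-1)^{k+1}\binom{\alpha/2}{k}\geq0$. A set $B\subset\mathbb{Z}^2$ is $S_\alpha$-massive if for every starting point $x$ the walk started at $x$ hits $B$ with probability $1$. $\Vert\cdot\Vert_\infty$ is the max-norm. A set $\mathcal{A}\subset\mathbb{Z}^2$ is radially bounded if there is $N>0$ such that $\#\{a\in\mathcal{A}:\Vert a\Vert_\infty=r\}\leq N$ for every $r>0$. A radially bounded set $\mathcal{A}$ is superlinear if the set of numbers $\{\Vert x\Vert_\infty:x\in\mathcal{A}\}$, enumerated in increasing order as $a_1<a_2<\dots$, satisfies $a_n\geq a_{n-k}+a_k$ for all $0<k<n$. *)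

(* Defs.v *)
From HB Require Import structures.
From mathcomp Require Import all_boot all_order all_algebra.
From mathcomp Require Import all_classical all_reals all_analysis.
Set Implicit Arguments. Unset Strict Implicit. Unset Printing Implicit Defensive.
Import Order.TTheory GRing.Theory Num.Theory.
Local Open Scope classical_set_scope.
Local Open Scope ring_scope.

Definition pt := (int * int)%type.
Definition ptadd (x y : pt) : pt := (x.1 + y.1, x.2 + y.2).

Definition supnorm (x : pt) : nat := maxn `|x.1|%N `|x.2|%N.

Section Walks.
Variable R : realType.

Fixpoint srw_pow (k : nat) (x y : pt) : R :=
  match k with
  | 0%N => (x == y)%:R
  | k'.+1 => 4^-1 * (srw_pow k' (ptadd x (1, 0)) y + srw_pow k' (ptadd x (-1, 0)) y
                    + srw_pow k' (ptadd x (0, 1)) y + srw_pow k' (ptadd x (0, -1)) y)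
  end.

Definition gbinom (a : R) (k : nat) : R :=
  (\prod_(i < k) (a - i%:R)) / (k`!)%:R.

Definition stable_coef (alpha : R) (k : nat) : R :=
  (-1) ^+ k.+1 * gbinom (alpha / 2) k.

Definition stable_kernel (alpha : R) (x y : pt) : \bar R :=
  (\sum_(1 <= k <oo) ((stable_coef alpha k * srw_pow k x y)%:E))%E.

Fixpoint hit_within (p : pt -> pt -> \bar R) (B : set pt) (n : nat) (x : pt)
  : \bar R :=
  match n with
  | 0%N => (`[< B x >])%:R%:E
  | n'.+1 => if `[< B x >] then 1%E
             else (\esum_(y in [set: pt]) (p x y * hit_within p B n' y))%E
  end.

Definition hit_prob (p : pt -> pt -> \bar R) (B : set pt) (x : pt) : \bar R :=
  ereal_sup (range (fun n => hit_within p B n x)).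

Definition massive (p : pt -> pt -> \bar R) (B : set pt) : Prop :=
  forall x : pt, hit_prob p B x = 1%E.

Definition stable_massive (alpha : R) (B : set pt) : Prop :=
  massive (stable_kernel alpha) B.

End Walks.

Definition radially_bounded (A : set pt) : Prop :=
  exists N : nat, forall r : nat, (0 < r)%N ->
    forall s : seq pt, uniq s ->
      (forall a, a \in s -> A a /\ supnorm a = r) -> (size s <= N)%N.

Definition norms (A : set pt) : set nat := supnorm @` A.

(* valid 1-based index for a (finite with L elements, or infinite) enumeration *)
Definition idx_ok (L : option nat) (n : nat) : bool :=
  (0 < n)%N && (if L is Some m then (n <= m)%N else true).

Definition increasing_enum (A : set pt) (L : option nat) (e : nat -> nat) : Prop :=
  (forall i j, idx_ok L i -> idx_ok L j -> (i < j)%N -> (e i < e j)%N) /\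
  norms A = e @` [set n | idx_ok L n].

Definition superlinear (A : set pt) : Prop :=
  radially_bounded A /\
  exists (L : option nat) (e : nat -> nat), increasing_enum A L e /\
    forall n k, idx_ok L n -> (0 < k)%N -> (k < n)%N ->
      (e (n - k)%N + e k <= e n)%N.

(* Main.v *)
Require Import Defs.
From HB Require Import structures.
From mathcomp Require Import all_boot all_order all_algebra.
From mathcomp Require Import all_classical all_reals all_analysis.
From mathcomp Require Import zify ring lra.
Import Order.TTheory GRing.Theory Num.Theory.
Local Open Scope classical_set_scope.
Local Open Scope ring_scope.
Set Implicit Arguments.
Unset Strict Implicit.
Unset Printing Implicit Defensive.

(** Write [a = alpha / 2].  Since [P_alpha = I - (I - P)^a], the Green function
    of [S_alpha] is [G = (I - P)^-a = sum_n g_n P^n], [g_n] being the coefficients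
    of [(1 - z)^-a].  The bounds [P^n (x, y) <= C min (1 / n, 1 / |x - y|^2)], and
    [>= c / n] for [n >= C |x - y|^2] up to parity, give
    [G (x, y) ~ g (|x - y|^2) ~ |x - y|^(alpha - 2)].

    If the series converges, the expected number of visits to [A] is finite,
    whereas a set which is hit almost surely from everywhere is visited
    infinitely often.

    If it diverges, pick one point [a_j] on each of the first [n] shells of [A].
    Superadditivity of the norms [e_j] gives [|a_i - a_j| >= e_(|i - j|)], so that
    [sum_j G (a_i, a_j)] is at most twice [s_n = sum_j G (0, a_j)], up to
    constants.  By the maximum principle, the probability to hit [A] from [x] is
    at least [sum_j G (x, a_j) / max_i sum_j G (a_i, a_j)], which as [s_n] tends
    to infinity is bounded below independently of [x].  A uniform lower bound
    on hitting probabilities forces them to be [1]. *)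

(** * Power series coefficients *)

(* Coefficients of [(1 - z)^-a]. *)
Fixpoint green_coef {R : realType} (a : R) (n : nat) : R :=
  if n is m.+1 then green_coef a m * ((m%:R + a) / m.+1%:R) else 1.
Arguments green_coef : simpl never.

Section Coefficients.
Context {R : realType}.
Implicit Types (a alpha : R) (n m : nat).

Let natS0 n : (n.+1%:R : R) != 0. Proof. by rewrite pnatr_eq0. Qed.
Let natS_gt0 n : 0 < n.+1%:R :> R. Proof. by rewrite ltr0n. Qed.

Lemma green_coefS a n :
  green_coef a n.+1 = green_coef a n * ((n%:R + a) / n.+1%:R).
Proof. by []. Qed.

Lemma green_coefSM a n :
  n.+1%:R * green_coef a n.+1 = (n%:R + a) * green_coef a n.
Proof. by rewrite green_coefS; have n0 := natS0 n; field. Qed.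

Lemma stable_coef0 alpha : stable_coef alpha 0 = -1.
Proof. by rewrite /stable_coef /gbinom big_ord0 fact0 invr1 !mulr1 expr1. Qed.

Lemma stable_coefSM alpha n :
  n.+1%:R * stable_coef alpha n.+1 = (n%:R - alpha / 2) * stable_coef alpha n.
Proof.
rewrite /stable_coef /gbinom big_ord_recr /= factS natrM exprS.
have n0 := natS0 n.
have f0 : (n`!)%:R != 0 :> R by rewrite pnatr_eq0 -lt0n fact_gt0.
move: (\prod_(i < n) _) ((-1) ^+ n.+1) => p s; field.
by rewrite f0 -natr1 in n0 *; rewrite addrC.
Qed.

(** The recursions [stable_coefSM] and [green_coefSM] say that the two generating functions satisfy
    (1 - z) c' = - a c and (1 - z) g' = a g, so their product F satisfies (1 - z) F' = 0. This is
    that equation, coefficient by coefficient; the factor n + 1 is split as k + (n + 1 - k). *)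
Lemma stable_green_conv alpha n :
  n.+1%:R * \sum_(k < n.+2) stable_coef alpha k * green_coef (alpha / 2) (n.+1 - k)
  = n%:R * \sum_(k < n.+1) stable_coef alpha k * green_coef (alpha / 2) (n - k).
Proof.
set c := stable_coef alpha; set g := green_coef _.
have -> : n.+1%:R * (\sum_(k < n.+2) c k * g (n.+1 - k)%N) =
  \sum_(k < n.+2) k%:R * c k * g (n.+1 - k)%N +
  \sum_(k < n.+2) c k * ((n.+1 - k)%N%:R * g (n.+1 - k)%N).
  rewrite mulr_sumr -big_split; apply: eq_bigr => -[k /= kn] _.
  rewrite natrB //; ring.
rewrite big_ord_recl /= !mul0r add0r [X in _ + X]big_ord_recr /= subnn mul0r.
rewrite mulr0 addr0 -big_split mulr_sumr; apply: eq_bigr => -[k /= kn] _.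
rewrite /bump /= add1n subSS subSn // /c /g stable_coefSM green_coefSM natrB //.
by ring.
Qed.

(* Comparison of coefficients in [(1 - z)^a * (1 - z)^-a = 1], [a = alpha / 2]. *)
Lemma green_coef_renewal alpha n :
  \sum_(k < n.+1) stable_coef alpha k.+1 * green_coef (alpha / 2) (n - k)
  = green_coef (alpha / 2) n.+1.
Proof.
have H : \sum_(k < n.+2) stable_coef alpha k * green_coef (alpha / 2) (n.+1 - k) = 0.
  elim: n => [|n IH].
    by apply/eqP; have /eqP := stable_green_conv alpha 0; rewrite mul0r mul1r.
  have /eqP := stable_green_conv alpha n.+1.
  by rewrite IH mulr0 mulf_eq0 pnatr_eq0 /= => /eqP.
move: H; rewrite big_ord_recl /= stable_coef0 subn0 mulN1r addrC => /eqP.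
rewrite subr_eq0 => /eqP <-.
by apply: eq_bigr => -[k kn] _ /=; rewrite /bump /= add1n subSS.
Qed.

Lemma stable_coef_ge0 alpha n : 0 <= alpha -> alpha <= 2 ->
  0 <= stable_coef alpha n.+1.
Proof.
move=> a0 a2; elim: n => [|n IH].
  have := stable_coefSM alpha 0; rewrite stable_coef0 mul1r => ->; lra.
rewrite -(pmulr_rge0 _ (natS_gt0 n.+1)) stable_coefSM mulr_ge0 //.
have : 1 <= n.+1%:R :> R by rewrite ler1n.
lra.
Qed.

(* [1 - sum_(k <= n) c_k] is the product of the [1 - alpha / (2 i)], [i <= n],
   hence at most a product which is [O (n ^ (-1/2))]. *)
Lemma stable_coef_tail alpha n : 1 <= alpha -> alpha <= 2 ->
  0 <= 1 - \sum_(k < n) stable_coef alpha k.+1 /\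
  (1 - \sum_(k < n) stable_coef alpha k.+1) ^+ 2 * n.+1%:R <= 1.
Proof.
move=> a1 a2; pose d m : R := 1 - \sum_(k < m) stable_coef alpha k.+1.
rewrite -/(d n).
have dc m : m.+1%:R * stable_coef alpha m.+1 = alpha / 2 * d m.
  elim: m => [|m IH].
    by rewrite stable_coefSM stable_coef0 /d big_ord0; lra.
  rewrite stable_coefSM /d big_ord_recr /= opprD addrA -/(d m).
  by rewrite mulrBl IH; ring.
have dS m : d m.+1 = d m * (1 - alpha / 2 / m.+1%:R).
  have -> : d m.+1 = d m - stable_coef alpha m.+1.
    by rewrite /d big_ord_recr /= opprD addrA.
  have := dc m; have := natS0 m => m0 /(congr1 (fun x => x / m.+1%:R)).
  by rewrite mulrAC divff // mul1r => ->; field.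
elim: n => [|n [IH0 IH]].
  by rewrite /d big_ord0 subr0 expr1n mul1r ler01 lexx.
have n0 := natS_gt0 n; rewrite dS.
set t : R := 1 - _.
have t0 : 0 <= t.
  rewrite subr_ge0 ler_pdivrMr // mul1r.
  have : 1 <= n.+1%:R :> R by rewrite ler1n.
  lra.
split; first exact: mulr_ge0.
apply: le_trans IH; rewrite exprMn -mulrA ler_wpM2l ?sqr_ge0 //.
set N := n.+1%:R in n0 *; rewrite -natr1 -/N.
(* As [alpha / 2] is at least 1/2, the new factor is at most 1 - 1 / (2 N), whose square times N + 1
   is at most N. *)
have t1 : t <= (2 * N - 1) / (2 * N).
  have -> : (2 * N - 1) / (2 * N) = 1 - 2^-1 / N by have := lt0r_neq0 n0 => ?; field.
  by rewrite lerD2l lerN2 ler_wpM2r // ?invr_ge0 ?(ltW n0) //; lra.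
apply: (@le_trans _ _ (((2 * N - 1) / (2 * N)) ^+ 2 * (N + 1))).
  rewrite ler_wpM2r //; first by lra.
  by rewrite ler_pXn2r // nnegrE // (le_trans t0).
rewrite expr_div_n mulrAC ler_pdivrMr ?exprn_gt0 ?mulr_gt0 // -subr_ge0.
have -> : N * (2 * N) ^+ 2 - (2 * N - 1) ^+ 2 * (N + 1) = 3 * N - 1 by ring.
have : 1 <= N by rewrite ler1n.
lra.
Qed.

Lemma green_coef_gt0 a n : 0 < a -> 0 < green_coef a n.
Proof.
move=> a0; elim: n => [|n IH]; first exact: ltr01.
rewrite green_coefS mulr_gt0 // divr_gt0 //.
by have := ler0n R n; lra.
Qed.

Lemma green_coefB a n :
  green_coef a n - green_coef a n.+1 = (1 - a) * (green_coef a n / n.+1%:R).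
Proof. by move: (natS0 n); rewrite green_coefS -natr1 => n0; field. Qed.

Lemma green_coef_anti a m n : 0 < a -> a <= 1 -> (m <= n)%N ->
  green_coef a n <= green_coef a m.
Proof.
move=> a0 a1.
apply: (@homo_leq R (green_coef a) (fun x y => y <= x)) => //.
  by move=> y x z xy yz; exact: le_trans yz xy.
move=> k; rewrite -subr_ge0 green_coefB mulr_ge0 //; first by lra.
by rewrite divr_ge0 // ltW // green_coef_gt0.
Qed.

Lemma green_coef_le1 a n : 0 < a -> a <= 1 -> green_coef a n <= 1.
Proof. by move=> a0 a1; exact: (@green_coef_anti a 0). Qed.

(** A substitute for regular variation: with [green_coef_anti] it makes the values of [green_coef]
    comparable at indices of bounded ratio. Consecutive terms have ratio (k + 2)(k + a) / (k + 1)^2,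
    which is at least 1 as soon as a >= 1/2, the worst case being k = 0. *)
Lemma green_coef_doubling a m n : 2^-1 <= a -> (m <= n)%N ->
  m.+1%:R * green_coef a m <= n.+1%:R * green_coef a n.
Proof.
move=> a_ge.
apply: (@homo_leq R (fun n => n.+1%:R * green_coef a n) <=%R) => //.
  by move=> y x z; exact: le_trans.
move=> k; rewrite green_coefS.
have g0 : 0 <= green_coef a k by rewrite ltW // green_coef_gt0 //; lra.
have := ler0n R k; have := natS0 k; rewrite -!natr1 => k0 kge.
have -> : (k%:R + 1 + 1) * (green_coef a k * ((k%:R + a) / (k%:R + 1))) =
  green_coef a k * ((k%:R + 1 + 1) * (k%:R + a) / (k%:R + 1)) by field.
rewrite mulrC ler_wpM2l // ler_pdivlMr; last by lra.
by nra.
Qed.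

(** For n > 0 both sides are the coefficient of z^(n-1) in (1 - z)^(-a-1). *)
Lemma sum_green_coef a n : 0 < a ->
  \sum_(0 <= k < n) green_coef a k = n%:R * green_coef a n / a.
Proof.
move=> /lt0r_neq0 a0.
elim: n => [|n IH]; first by rewrite big_geq // !mul0r.
rewrite big_nat_recr //= IH green_coefS; have := natS0 n; rewrite -natr1 => n0.
by field; rewrite a0.
Qed.

(** By [green_coefB] the sum telescopes. *)
Lemma sum_green_coef_tail a m n : 0 < a -> a < 1 -> (m <= n)%N ->
  \sum_(m <= k < n) green_coef a k / k.+1%:R <= green_coef a m / (1 - a).
Proof.
move=> a0 a1 mn; have b0 : 0 < 1 - a by lra.
rewrite ler_pdivlMr // mulrC mulr_sumr.
under eq_bigr do rewrite -green_coefB.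
rewrite (telescope_sumr_eq (fun k => - green_coef a k)) //; last first.
  by move=> k _; rewrite opprK addrC.
by rewrite opprK addrC gerBl ltW // green_coef_gt0.
Qed.

(** Concavity of [ln] between the points 1 + x and 1, with weights b and 1 - b. *)
Lemma powR_bernoulli (b x : R) : 0 <= b <= 1 -> 0 < 1 + x ->
  (1 + x) `^ b <= 1 + b * x.
Proof.
move=> /andP[b0 b1] x0.
have t1 : 0 < 1 + b * x.
  have [->|bN0] := eqVneq b 0; first by rewrite mul0r addr0.
  have -> : 1 + b * x = (1 - b) + b * (1 + x) by ring.
  by rewrite ltr_wpDl ?subr_ge0 // mulr_gt0 // lt_neqAle eq_sym bN0.
rewrite /powR gt_eqF // -[leRHS]lnK ?posrE // ler_expR.
have H := @concave_ln R (Itv01 b0 b1) (1 + x) 1 x0 ltr01.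
move: H; rewrite !convRE /= ln1 mulr0 addr0 mulr1.
rewrite /unstable.onem.
have -> : b * (1 + x) + (1 - b) = 1 + b * x by ring.
by [].
Qed.

(** By Bernoulli's inequality n^(1-a) g_n is nondecreasing from its value a >= 1/2 at n = 1, while
    (n + 1)^(1-a) g_n is nonincreasing from its value 1 at n = 0. *)
Lemma green_coef_powR a n : 2^-1 <= a -> a < 1 -> (0 < n)%N ->
  2^-1 * (n%:R `^ (1 - a))^-1 <= green_coef a n <= (n%:R `^ (1 - a))^-1.
Proof.
move=> a_ge a_lt; have b01 : 0 <= 1 - a <= 1 by lra.
have powS (m : nat) : 0 < m.+1%:R `^ (1 - a) by rewrite powR_gt0.
case: n => // n _; apply/andP; split.
  rewrite ler_pdivrMr //; elim: n => [|n IH].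
    by rewrite powR1 mulr1 green_coefS add0r divr1 mul1r.
  apply: (le_trans IH); rewrite (green_coefS a n.+1) -[leRHS]mulrA.
  apply: ler_wpM2l.
    by rewrite ltW // green_coef_gt0 //; lra.
  have n2 := natS0 n.+1; have n2_gt0 := natS_gt0 n.+1.
  have E1 : 1 + - n.+2%:R^-1 = n.+1%:R / n.+2%:R :> R.
    by rewrite -[n.+2]addn1 natrD in n2 *; field.
  have n1 : 0 < 1 + - n.+2%:R^-1 :> R by rewrite E1 divr_gt0.
  have := powR_bernoulli b01 n1; rewrite E1 => H.
  have <- : n.+2%:R `^ (1 - a) * (n.+1%:R / n.+2%:R) `^ (1 - a) =
            n.+1%:R `^ (1 - a).
    by rewrite -powRM ?divr_ge0 // mulrC divfK.
  rewrite mulrC ler_wpM2r ?powR_ge0 //; apply: (le_trans H).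
  by rewrite -[n.+2]addn1 natrD in n2 *; rewrite le_eqVlt; apply/orP; left;
     apply/eqP; field.
(* The bound with the base shifted by one is the one that passes through the induction. *)
apply: (@le_trans _ _ (n.+2%:R `^ (1 - a))^-1); last first.
  by rewrite lef_pV2 ?posrE // ge0_ler_powR ?nnegrE // ?ler_nat //; lra.
elim: n.+1 => {n} [|n IH]; first by rewrite powR1 invr1.
have n1 := natS0 n; have n1_gt0 := natS_gt0 n.
have x0 : 0 < 1 + n.+1%:R^-1 :> R by rewrite addr_gt0 // invr_gt0.
rewrite green_coefS -[leRHS]mul1r ler_pdivlMr //.
have -> : n.+2%:R = n.+1%:R * (1 + n.+1%:R^-1) :> R.
  by rewrite -[n.+2]addn1 natrD; field.
rewrite powRM ?(ltW x0) //.
have H := powR_bernoulli b01 x0.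
have Hn : 0 <= (n%:R + a) / n.+1%:R.
  by rewrite divr_ge0 // addr_ge0 //; lra.
apply: (@le_trans _ _ ((n.+1%:R `^ (1 - a))^-1 * ((n%:R + a) / n.+1%:R) *
    (n.+1%:R `^ (1 - a) * (1 + (1 - a) * n.+1%:R^-1)))).
  apply: ler_pM.
  - by rewrite mulr_ge0 // ltW // green_coef_gt0 //; lra.
  - by rewrite mulr_ge0 ?powR_ge0.
  - exact: ler_wpM2r.
  - by rewrite ler_wpM2l ?powR_ge0.
have -> : (n%:R + a) / n.+1%:R = 1 - (1 - a) * n.+1%:R^-1.
  by move: n1; rewrite -natr1 => n1; field.
rewrite mulrACA mulrA mulVf ?gt_eqF // mul1r.
set y := (1 - a) * _; have : 0 <= y ^+ 2 by exact: sqr_ge0.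
by nra.
Qed.
End Coefficients.

(** * Heat kernel estimates *)

Fixpoint rw1 {R : realType} (n : nat) (m : int) : R :=
  if n is n'.+1 then (rw1 n' (m - 1) + rw1 n' (m + 1)) / 2 else (m == 0)%:R.
Arguments rw1 : simpl never.

Section HeatKernel.
Context {R : realType}.
Implicit Types (n k : nat) (x y : pt).
Local Notation q := (@rw1 R).

Lemma rw1S n (m : int) : q n.+1 m = (q n (m - 1) + q n (m + 1)) / 2.
Proof. by []. Qed.

Lemma rw1_0 (m : int) : q 0 m = (m == 0)%:R. Proof. by []. Qed.

(* In the coordinates [x + y], [x - y] the walk splits into two independent
   one-dimensional walks. *)
Lemma srw_powE n x y : srw_pow R n x y =
  q n ((y.1 - x.1) + (y.2 - x.2)) * q n ((y.1 - x.1) - (y.2 - x.2)).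
Proof.
case: y => y1 y2; elim: n x => [|n IH] [x1 x2] /=.
  rewrite !rw1_0 -natrM mulnb; congr (_%:R); congr nat_of_bool.
  apply/eqP/andP => [[-> ->]|[/eqP h1 /eqP h2]]; first by rewrite !subrr.
  by congr (_, _); lia.
rewrite !IH /= !rw1S.
have e1 (a b : int) : y1 - (x1 + a) + (y2 - (x2 + b)) =
   (y1 - x1 + (y2 - x2)) - (a + b) by ring.
have e2 (a b : int) : y1 - (x1 + a) - (y2 - (x2 + b)) =
   (y1 - x1 - (y2 - x2)) - (a - b) by ring.
rewrite !e1 !e2 !(addr0, subr0, add0r, sub0r) !opprK.
by field.
Qed.

Lemma rw1_ge0 n m : 0 <= q n m.
Proof.
elim: n m => [|n IH] m; first by rewrite rw1_0.
by rewrite rw1S divr_ge0 // addr_ge0.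
Qed.

Lemma rw1N n m : q n (- m) = q n m.
Proof.
elim: n m => [|n IH] m; first by rewrite !rw1_0 oppr_eq0.
rewrite !rw1S addrC -(IH (m - 1)) -(IH (m + 1)).
by congr ((q _ _ + q _ _) / 2); ring.
Qed.

Lemma rw1_absz n m : q n m = q n `|m|%N%:Z.
Proof. by case: m => m //; rewrite NegzE rw1N. Qed.

(* Ratio of neighbouring binomial coefficients: if [n + m] is even, then
   [q n m = 'C(n, (n + m) / 2) / 2 ^ n]. *)
Lemma rw1_ratioZ n m :
  (n%:R + m%:~R + 2) * q n (m + 2) = (n%:R - m%:~R) * q n m.
Proof.
elim: n m => [|n IH] m.
  rewrite !rw1_0; have [->|m0] := eqVneq m 0; first by rewrite mulr0 !subrr mul0r.
  rewrite mulr0; have [/eqP|_] := eqVneq (m + 2) 0; last by rewrite mulr0.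
  by rewrite addr_eq0 => /eqP ->; rewrite mulr1; ring.
have H1 := IH (m + 1); have H2 := IH (m - 1).
have e1 : m + 1 + 2 = m + 2 + 1 :> int by ring.
have e2 : m - 1 + 2 = m + 1 :> int by ring.
have e3 : m + 2 - 1 = m + 1 :> int by ring.
move: H1 H2; rewrite !rw1S e1 e2 e3 -(natr1 n) !intrD !intrN !mulr1z.
move: (q n _) (q n (m + 1)) (q n _) => A B C; lra.
Qed.

Lemma rw1_ratio n m :
  (n%:R + m%:R + 2) * q n m.+2 = (n%:R - m%:R) * q n m.
Proof. by have := rw1_ratioZ n m; rewrite -!pmulrn -PoszD addn2. Qed.

Lemma rw1_anti2 n m : q n m.+2 <= q n m.
Proof.
have := rw1_ratio n m; have := rw1_ge0 n m.
have n0 := ler0n R n; have m0 := ler0n R m.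
move: (q n _) (q n _) => A B B0 e.
have h : 0 < n%:R + m%:R + 2 :> R by lra.
rewrite -(ler_pM2l h) e ler_wpM2r //; lra.
Qed.

Lemma rw1S0 n : q n.+1 0 = q n 1.
Proof. by rewrite rw1S sub0r add0r rw1N; field. Qed.

Lemma rw1SS0 n : n.+2%:R * q n.+2 0 = n.+1%:R * q n 0.
Proof.
rewrite rw1S0 rw1S subrr; have := rw1_ratio n 0.
rewrite (_ : 1 + 1 = 2%N%:Z :> int) // addr0 subr0 -(natr1 n) -[n.+2]addn2 natrD.
move: (q n _) (q n _) => A B; lra.
Qed.

(** By [rw1SS0] a double step multiplies the left side by (n + 1)(n + 3) / (n + 2)^2 <= 1, hence an
    induction in steps of two. *)
Lemma rw1_origin_le n : (q n 0) ^+ 2 * n.+1%:R <= 1.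
Proof.
have [m] := ubnP n; elim: m n => // m IH [|[|n]] nm.
- by rewrite rw1_0 eqxx expr1n mul1r.
- rewrite rw1S0 rw1_0 /= expr0n mul0r; exact: ler01.
have := IH n ltac:(lia); have := rw1SS0 n.
move: (q n 0) (q n.+2 0) (rw1_ge0 n 0) (rw1_ge0 n.+2 0) => A B A0 B0.
rewrite -!natr1; set N : R := n%:R; have N0 : 0 <= N by exact: ler0n.
move=> e h; have N2 : 0 < N + 2 by lra.
have -> : B = (N + 1) * A / (N + 2).
  by rewrite -e -[N + 1 + 1]addrA mulrAC divff ?mul1r // lt0r_neq0.
apply: le_trans h; rewrite expr_div_n exprMn.
have -> : (N + 1) ^+ 2 * A ^+ 2 / (N + 2) ^+ 2 * (N + 1 + 1 + 1) =
   A ^+ 2 * (N + 1) * ((N + 1) * (N + 3) / (N + 2) ^+ 2).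
  by field; rewrite lt0r_neq0.
rewrite ler_piMr ?mulr_ge0 ?sqr_ge0 //; first by lra.
by rewrite ler_pdivrMr ?exprn_gt0 // mul1r; nra.
Qed.

(** Descending by two leads to m = 0 or m = 1, and the value at 1 is the return probability at time
    n + 1. *)
Lemma rw1_le n m : (q n m) ^+ 2 * n.+1%:R <= 1.
Proof.
rewrite rw1_absz; move: `|m|%N => {}m.
have [k] := ubnP m; elim: k m => // k IH [|[|m]] mk.
- exact: rw1_origin_le.
- rewrite -rw1S0; apply: le_trans (rw1_origin_le n.+1).
  by rewrite ler_wpM2l ?sqr_ge0 // ler_nat.
apply: le_trans (IH m ltac:(lia)); rewrite ler_wpM2r //.
by rewrite ler_pXn2r ?nnegrE ?rw1_ge0 ?rw1_anti2.
Qed.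

(* [m ^ 2 * q n m] decreases along [m -> m + 2] once [m ^ 2 > 9 (n + 1)]. *)
Lemma rw1_decay n m : (m%:R ^+ 2 * q n m) ^+ 2 <= 81 * n.+1%:R.
Proof.
have [k] := ubnP m; elim: k m => // k IH m mk.
(* Below the threshold the bound follows from [rw1_le], with 81 = 9^2; above it the induction
   descends by two. *)
have [small|large] := leqP (m ^ 2) (9 * n.+1).
  rewrite exprMn; have := rw1_le n m.
  have : m%:R ^+ 2 <= 9 * n.+1%:R :> R by rewrite -natrX -natrM ler_nat.
  have : 0 <= m%:R ^+ 2 :> R by exact: sqr_ge0.
  move: (m%:R ^+ 2) (q n m ^+ 2) (sqr_ge0 (q n m)) => M Q Q0 M0 h1 h2.
  set N : R := n.+1%:R in h1 h2 *; have N0 : 0 <= N by exact: ler0n.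
  apply: (@le_trans _ _ ((9 * N) ^+ 2 * Q)).
    by rewrite ler_wpM2r // ler_pXn2r // nnegrE mulr_ge0.
  have -> : (9 * N) ^+ 2 * Q = 81 * N * (Q * N) by ring.
  by rewrite ler_piMr // mulr_ge0.
case: m mk large => [|[|m]] mk large; [by lia|by lia|].
apply: le_trans (IH m ltac:(lia)).
rewrite ler_pXn2r ?nnegrE ?mulr_ge0 ?sqr_ge0 ?rw1_ge0 //.
have N0 := ler0n R n; have M0 := ler0n R m.
have h : 0 < n%:R + m%:R + 2 :> R by lra.
rewrite -(ler_pM2l h) [leLHS]mulrCA rw1_ratio mulrCA mulrA [leRHS]mulrA.
rewrite ler_wpM2r ?rw1_ge0 //.
have : (9 * n.+1)%N%:R <= (m.+2 ^ 2)%N%:R :> R by rewrite ler_nat ltnW.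
have : 1 <= m%:R :> R by rewrite ler1n; nia.
rewrite natrM natrX -natr1 -[m.+2]addn2 natrD.
set M : R := m%:R; set N : R := n%:R => M1 L.
rewrite -subr_ge0.
have -> : (N + M + 2) * M ^+ 2 - (N - M) * (M + 2%:R) ^+ 2 =
  2 * (M + 1) * ((M + 2) * M - 2 * N) by ring.
by rewrite mulr_ge0 ?mulr_ge0 //; [lra|nra].
Qed.

(** The right side is nondecreasing in n: by [rw1SS0] this amounts to (2n + 1)^2 (4n + 5) >= (2n +
    2)^2 (4n + 1), whose two sides differ by 1. *)
Lemma rw1_origin_ge n : 1 <= (q n.*2 0) ^+ 2 * (4 * n%:R + 1).
Proof.
elim: n => [|n IH]; first by rewrite rw1_0 eqxx expr1n mul1r mulr0 add0r.
apply: (le_trans IH); rewrite doubleS.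
have := rw1SS0 n.*2.
move: (q n.*2 0) (q _.+2 0) (rw1_ge0 n.*2 0) (rw1_ge0 n.*2.+2 0) => A B A0 B0.
rewrite -(natr1 n.*2.+1) -(natr1 n.*2) -(natr1 n) -muln2 natrM; set N : R := n%:R.
have N0 : 0 <= N by exact: ler0n.
move=> e; have N2 : 0 < 2 * N + 2 by lra.
have -> : B = (2 * N + 1) * A / (2 * N + 2).
  apply: (mulfI (lt0r_neq0 N2)); rewrite [RHS]mulrCA divff ?lt0r_neq0 //.
  by move: e; lra.
rewrite expr_div_n exprMn.
have -> : (2 * N + 1) ^+ 2 * A ^+ 2 / (2 * N + 2) ^+ 2 * (4 * (N + 1) + 1) =
   A ^+ 2 * ((2 * N + 1) ^+ 2 * (4 * (N + 1) + 1) / (2 * N + 2) ^+ 2).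
  by field; rewrite lt0r_neq0.
by rewrite ler_wpM2l ?sqr_ge0 // ler_pdivlMr ?exprn_gt0 //; nra.
Qed.

(** This quadratic bound near the origin replaces a local limit theorem. It comes from multiplying
    the ratios (n - m) / (n + m + 2) of [rw1_ratio]. Where the lower bound is negative it is
    trivial; otherwise (m + 2)^2 <= 2 n, which keeps n - m nonnegative. *)
Lemma rw1_even_ge n j : (0 < n)%N ->
  q n 0 * (1 - j.*2%:R ^+ 2 / (2 * n%:R)) <= q n j.*2.
Proof.
move=> n0; have N0 : 0 < n%:R :> R by rewrite ltr0n.
elim: j => [|j IH]; first by rewrite expr0n mul0r subr0 mulr1.
rewrite doubleS; move: j.*2 IH => m IH.
set t : R := 1 - _; have [t0|t0] := ltP t 0.
  by apply: le_trans (rw1_ge0 _ _); rewrite nmulr_lle0 // rw1_ge0.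
have M0 : 0 <= m%:R :> R by exact: ler0n.
have h : 0 < n%:R + m%:R + 2 :> R by lra.
rewrite -(ler_pM2l h) rw1_ratio.
move: t0; rewrite /t -[m.+2]addn2 natrD.
move: (q n 0) (q n m) (rw1_ge0 n 0) IH => A B A0 IH t0.
set M : R := m%:R in M0 h IH t0 *; set N : R := n%:R in N0 h IH t0 *.
have E : (M + 2%:R) ^+ 2 <= 2 * N.
  by move: t0; rewrite subr_ge0 ler_pdivrMr ?mul1r ?mulr_gt0.
apply: (@le_trans _ _ ((N - M) * (A * (1 - M ^+ 2 / (2 * N))))); last first.
  by rewrite ler_wpM2l //; nra.
rewrite mulrCA [leRHS]mulrCA ler_wpM2l // -subr_ge0.
have -> : (N - M) * (1 - M ^+ 2 / (2 * N)) -
   (N + M + 2) * (1 - (M + 2%:R) ^+ 2 / (2 * N)) =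
   ((M + 2) ^+ 2 * (M + 2) + M ^+ 2 * M) / (2 * N) by field; rewrite lt0r_neq0.
by rewrite divr_ge0 ?addr_ge0 ?mulr_ge0 ?sqr_ge0 //; lra.
Qed.

Lemma rw1_even_half n j : (0 < n)%N -> (j.*2 ^ 2 <= n)%N ->
  q n 0 / 2 <= q n j.*2.
Proof.
move=> n0 jn; apply: le_trans (rw1_even_ge j n0).
rewrite ler_wpM2l ?rw1_ge0 //.
have N0 : 0 < n%:R :> R by rewrite ltr0n.
have : j.*2%:R ^+ 2 / (2 * n%:R) <= 2^-1 :> R.
  rewrite ler_pdivrMr ?mulr_gt0 // mulrA mulVf ?mul1r ?pnatr_eq0 //.
  by rewrite -natrX ler_nat.
lra.
Qed.

Lemma rw1_odd_quarter n j : (0 < n)%N -> (j.*2 ^ 2 <= n)%N ->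
  q n 0 / 4 <= q n.+1 j.*2.+1.
Proof.
move=> n0 jn; have := rw1_even_half n0 jn.
rewrite rw1S (_ : j.*2.+1%:Z - 1 = j.*2%:Z); last by lia.
by have := rw1_ge0 n (j.*2.+1%:Z + 1); lra.
Qed.

Definition pdist x y : nat := supnorm (y.1 - x.1, y.2 - x.2).

Lemma srw_pow_ge0 n x y : 0 <= srw_pow R n x y.
Proof. by rewrite srw_powE mulr_ge0 ?rw1_ge0. Qed.

Lemma srw_pow_le n x y : srw_pow R n x y <= n.+1%:R^-1.
Proof.
rewrite srw_powE.
move: (y.1 - x.1 + (y.2 - x.2)) (y.1 - x.1 - (y.2 - x.2)) => u v.
have := rw1_le n u; have := rw1_le n v; have n0 : 0 < n.+1%:R :> R by rewrite ltr0n.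
rewrite -![_ * n.+1%:R <= 1]ler_pdivlMr // !mul1r.
by move: (q n u) (q n v) n.+1%:R^-1 => A B C; have := sqr_ge0 (A - B); lra.
Qed.

(** The growth sqrt(n + 1) allowed by [rw1_decay] for one factor is cancelled by the bound 1 /
    sqrt(n + 1) on the other, so the result is uniform in n. *)
Lemma rw1_mul_decay n (r : nat) (u v : int) : (r <= `|u|)%N ->
  r%:R ^+ 2 * (q n u * q n v) <= 9.
Proof.
move=> ru; have n0 : 0 < n.+1%:R :> R by rewrite ltr0n.
apply: (@le_trans _ _ (`|u|%N%:R ^+ 2 * q n u * q n v)).
  rewrite -mulrA ler_wpM2r ?mulr_ge0 ?rw1_ge0 //.
  by rewrite -!natrX ler_nat leq_exp2r.
have := rw1_decay n `|u|; rewrite -rw1_absz.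
have : 0 <= `|u|%N%:R ^+ 2 * q n u by rewrite mulr_ge0 ?sqr_ge0 ?rw1_ge0.
move: (_ * q n u) => D D0 Dle; have := rw1_le n v.
move: (q n v) (rw1_ge0 n v) => B B0 Ble.
rewrite -(@ler_pXn2r _ 2) ?nnegrE ?mulr_ge0 // exprMn.
have -> : 9 ^+ 2 = 81 :> R by ring.
rewrite -(ler_pM2r n0); apply: le_trans Dle.
by rewrite -mulrA ler_piMr // sqr_ge0.
Qed.

Lemma srw_pow_decay n x y : (pdist x y)%:R ^+ 2 * srw_pow R n x y <= 9.
Proof.
rewrite srw_powE /pdist /supnorm /=; set a : int := y.1 - _; set b : int := y.2 - _.
(* One of the two rotated coordinates is at least the max-norm in absolute value. *)
have [h|h] : (maxn `|a| `|b| <= `|(a + b)%R|)%N \/ (maxn `|a| `|b| <= `|(a - b)%R|)%N.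
  by lia.
  exact: rw1_mul_decay.
by rewrite [q _ _ * _]mulrC; exact: rw1_mul_decay.
Qed.

(** Adding two consecutive times removes the parity obstruction. The distance is doubled because the
    rotated coordinates are at most twice the max-norm, and 16 is the product of the two factors 4
    of [rw1_odd_quarter]. *)
Lemma srw_pow_near k x y : (0 < k)%N -> ((pdist x y).*2 ^ 2 <= k.*2)%N ->
  (16 * (4 * k%:R + 1))^-1 <= srw_pow R k.*2 x y + srw_pow R k.*2.+1 x y.
Proof.
move=> k0 kr; have kk : (0 < k.*2)%N by rewrite double_gt0.
have k1 : 0 < 4 * k%:R + 1 :> R by rewrite ltr_wpDl // mulr_ge0.
have H0 : (16 * (4 * k%:R + 1))^-1 <= q k.*2 0 / 4 * (q k.*2 0 / 4).
  rewrite invfM -ler_pdivlMl ?invr_gt0 // invrK -[_^-1]mul1r ler_pdivrMr //.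
  by apply: le_trans (rw1_origin_ge k) _; rewrite le_eqVlt; apply/orP; left;
     apply/eqP; field.
apply: (le_trans H0) => {H0}.
move: (srw_pow_ge0 k.*2 x y) (srw_pow_ge0 k.*2.+1 x y).
rewrite !srw_powE; move: kr; rewrite /pdist /supnorm /=.
set a : int := y.1 - _; set b : int := y.2 - _ => kr; set p1 := _ * q _ _; set p2 := _ * q _ _.
have q0 := rw1_ge0 k.*2 0; move=> p1_ge0 p2_ge0.
have sq (j : nat) : (j.*2 <= `|(a + b)%R|)%N \/ (j.*2 <= `|(a - b)%R|)%N ->
    (j.*2 ^ 2 <= k.*2)%N.
  move=> h; apply: leq_trans kr; rewrite leq_exp2r //.
  have : (j.*2 <= (maxn `|a| `|b|).*2)%N by lia.
  by rewrite leq_double.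
(* The rotated coordinates a + b and a - b have the same parity: if odd, time 2k + 1 contributes, if
   even, time 2k. *)
have [odd_u|even_u] := boolP (odd `|(a + b)%R|%N).
- have [j ju] : exists j, `|(a + b)%R|%N = j.*2.+1.
    by exists `|(a + b)%R|%N./2; rewrite -[LHS]odd_double_half odd_u.
  have [i iv] : exists i, `|(a - b)%R|%N = i.*2.+1.
    have odd_v : odd `|(a - b)%R|%N by lia.
    by exists `|(a - b)%R|%N./2; rewrite -[LHS]odd_double_half odd_v.
  have hj := rw1_odd_quarter kk (sq j ltac:(lia)).
  have hi := rw1_odd_quarter kk (sq i ltac:(lia)).
  apply: (@le_trans _ _ p2); last by rewrite lerDr.
  rewrite /p2 (rw1_absz _ (a + b)) (rw1_absz _ (a - b)) ju iv.
  by apply: ler_pM; rewrite ?divr_ge0.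
have [j ju] : exists j, `|(a + b)%R|%N = j.*2.
  by exists `|(a + b)%R|%N./2; rewrite -[LHS]odd_double_half (negbTE even_u).
have [i iv] : exists i, `|(a - b)%R|%N = i.*2.
  have /negbTE even_v : ~~ odd `|(a - b)%R|%N by lia.
  by exists `|(a - b)%R|%N./2; rewrite -[LHS]odd_double_half even_v.
have hj := rw1_even_half kk (sq j ltac:(lia)).
have hi := rw1_even_half kk (sq i ltac:(lia)).
apply: (@le_trans _ _ p1); last by rewrite lerDl.
rewrite /p1 (rw1_absz _ (a + b)) (rw1_absz _ (a - b)) ju iv.
by apply: ler_pM; rewrite ?divr_ge0 //; lra.
Qed.

(** * Two-sided bounds for partial sums of the Green series *)

Section Green.
Variable a : R.
Local Notation g := (green_coef a).
Local Notation phi r := (g (r ^ 2)%N).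

(** The sum is cut at N, the squared distance. Before N the bound 9 / N on the heat kernel and
    [sum_green_coef] give 9 g_N / a; after N the bound 1 / (n + 1) and [sum_green_coef_tail] give
    g_N / (1 - a). *)
Lemma green_partial_le M x y : 2^-1 <= a -> a < 1 ->
  \sum_(0 <= n < M) g n * srw_pow R n x y <= (9 / a + (1 - a)^-1) * phi (pdist x y).
Proof.
move=> a_ge a_lt; have a0 : 0 < a by lra.
have g0 n : 0 <= g n by rewrite ltW // green_coef_gt0.
set N := (_ ^ 2)%N; have a1 : 0 < (1 - a) by lra.
apply: (@le_trans _ _ (\sum_(0 <= n < maxn M N) g n * srw_pow R n x y)).
  rewrite [leRHS](big_cat_nat _ (n := M)) ?leq_maxl //= lerDl sumr_ge0 //.
  by move=> n _; rewrite mulr_ge0 ?srw_pow_ge0.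
rewrite (big_cat_nat _ (n := N)) ?leq_maxr //= mulrDl lerD //.
  have [N0|N0] := posnP N; first by rewrite N0 big_geq // mulr_ge0 // ?divr_ge0 // ltW.
  have NR : 0 < N%:R :> R by rewrite ltr0n.
  apply: (@le_trans _ _ (\sum_(0 <= n < N) g n * (9 / N%:R))).
    apply: ler_sum_nat => n _; rewrite ler_wpM2l // ler_pdivlMr // mulrC.
    by rewrite /N natrX srw_pow_decay.
  rewrite -mulr_suml sum_green_coef // le_eqVlt; apply/orP; left; apply/eqP.
  by field; rewrite !lt0r_neq0.
rewrite mulrC; apply: le_trans (sum_green_coef_tail a0 a_lt (leq_maxr M N)).
by apply: ler_sum_nat => n _; rewrite ler_wpM2l // srw_pow_le.
Qed.

Lemma sum_nat_double (F : nat -> R) m :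
  \sum_(0 <= n < m.*2) F n = \sum_(0 <= k < m) (F k.*2 + F k.*2.+1).
Proof.
elim: m => [|m IH]; first by rewrite !big_geq.
by rewrite doubleS !big_nat_recr //= IH addrA.
Qed.

Lemma green_partial_ge x y : 2^-1 <= a -> a < 1 -> exists M,
  phi (pdist x y) / 1152 <= \sum_(0 <= n < M) g n * srw_pow R n x y.
Proof.
move=> a_ge a_lt; have a0 : 0 < a by lra.
have g0 n : 0 <= g n by rewrite ltW // green_coef_gt0.
(* Only times in [4K, 8K) are kept: 2K pairs of times, each of weight at least 1 / (256 K), give
   1/128, and on this range [green_coef] is at least g_N / 9; hence 1152 = 9 * 128. Taking K = N + 1
   covers distance 0. *)
set N := (_ ^ 2)%N; pose K := N.+1; exists (4 * K).*2.
apply: (@le_trans _ _ (g (4 * K).*2 * \sum_(0 <= n < (4 * K).*2) srw_pow R n x y)); last first.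
  rewrite mulr_sumr; apply: ler_sum_nat => n /andP[_ nK].
  rewrite ler_wpM2r ?srw_pow_ge0 // green_coef_anti //; [exact: ltW|exact: ltnW].
have K0 : 0 < K%:R :> R by rewrite ltr0n.
have h1 : phi (pdist x y) / 9 <= g (4 * K).*2.
  rewrite ler_pdivrMr // -(ler_pM2l K0).
  have NK : (N <= (4 * K).*2)%N by rewrite /K; lia.
  apply: le_trans (green_coef_doubling a_ge NK) _.
  rewrite mulrC [leRHS]mulrCA ler_wpM2l // -natrM ler_nat /K; lia.
have h2 : 128^-1 <= \sum_(0 <= n < (4 * K).*2) srw_pow R n x y.
  rewrite sum_nat_double (big_cat_nat _ (n := 2 * K)) //; last by lia.
  apply: ler_wpDl; first by apply: sumr_ge0 => k _; rewrite addr_ge0 ?srw_pow_ge0.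
  apply: (@le_trans _ _ (\sum_(2 * K <= k < 4 * K) (256 * K%:R)^-1)).
    rewrite sumr_const_nat.
    have -> : (4 * K - 2 * K = 2 * K)%N by lia.
    rewrite -[leRHS]mulr_natr natrM le_eqVlt; apply/orP; left; apply/eqP.
    by field; rewrite lt0r_neq0.
  apply: ler_sum_nat => k /andP[Kk kK]; apply: le_trans (srw_pow_near _ _); last 2 first.
  - by rewrite /K in Kk; lia.
  - by move: Kk; rewrite /K /N; nia.
  have k1 : 0 < 4 * k%:R + 1 :> R by rewrite ltr_wpDl // mulr_ge0.
  rewrite lef_pV2 ?posrE ?mulr_gt0 //.
  have : k%:R + 1 <= 4 * K%:R :> R by rewrite natr1 -natrM ler_nat.
  lra.
have -> : phi (pdist x y) / 1152 = phi (pdist x y) / 9 * 128^-1 by field.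
by apply: ler_pM => //; rewrite ?divr_ge0 ?invr_ge0.
Qed.

End Green.
End HeatKernel.

(** * Hitting probabilities and potentials *)

Section EsumExtra.
Context {R : realType} {T : choiceType}.
Local Open Scope ereal_scope.

Lemma esumZl (I : set T) (r : R) (f : T -> \bar R) : (0 <= r)%R ->
  (forall i, 0 <= f i) ->
  \esum_(i in I) (r%:E * f i) = r%:E * \esum_(i in I) f i.
Proof.
move=> r0 f0; rewrite /esum -ereal_supZl //; last first.
  by apply/set0P; exists (\sum_(x \in set0) f x), set0 => //; exact: fsets_set0.
congr ereal_sup; apply/seteqP; split => [_ [A SA <-]|_ [_ [A SA <-] <-]].
  by exists (\sum_(x \in A) f x); [exists A|rewrite ge0_mule_fsumr].
by exists A => //; rewrite ge0_mule_fsumr.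
Qed.

Lemma esum_nneseries (I : set T) (f : T -> nat -> \bar R) :
  (forall i k, 0 <= f i k) ->
  \esum_(i in I) \sum_(k <oo) f i k = \sum_(k <oo) \esum_(i in I) f i k.
Proof.
move=> f0; rewrite nneseries_esumT; last by move=> k; exact: esum_ge0.
under eq_esum do rewrite nneseries_esumT //.
rewrite !esum_esum //.
rewrite (reindex_esum ([set: nat] `*`` (fun=> I)) _ (fun x => (x.2, x.1))) //.
split => [[i j] []//|[i1 i2] [j1 j2] _ _ [-> ->]//|[i j] [] Ii _].
by exists (j, i).
Qed.
End EsumExtra.

Section Hitting.
Context {R : realType}.
Variable p : pt -> pt -> \bar R.
Local Open Scope ereal_scope.
Local Notation "'Q' f" := (fun x => \esum_(y in [set: pt]) (p x y * f y))
  (at level 10, f at next level).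
Hypothesis p_ge0 : forall x y, 0 <= p x y.
Hypothesis p_stochastic : forall x, \esum_(y in [set: pt]) p x y = 1.
Implicit Types (A B : set pt) (f : pt -> \bar R).

Lemma step_le f g x : (forall y, 0 <= f y) -> (forall y, f y <= g y) ->
  Q f x <= Q g x.
Proof. by move=> f0 fg; apply: le_esum => y _; rewrite lee_wpmul2l. Qed.

Lemma step_lin f g (r : R) x : (0 <= r)%R ->
  (forall y, 0 <= f y) -> (forall y, 0 <= g y) ->
  Q (fun y => r%:E * f y + g y) x = r%:E * Q f x + Q g x.
Proof.
move=> r0 f0 g0; rewrite -esumZl //; last by move=> y; rewrite mule_ge0.
rewrite -esumD; first last.
- by move=> y _; rewrite mule_ge0.
- by move=> y _; rewrite !mule_ge0.
by apply: eq_esum => y _; rewrite ge0_muleDr ?mule_ge0 // muleCA.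
Qed.

Lemma step_cst (r : R) x : (0 <= r)%R -> Q (fun=> r%:E) x = r%:E.
Proof.
move=> r0; transitivity (\esum_(y in [set: pt]) (r%:E * p x y)).
  by apply: eq_esum => y _; rewrite muleC.
by rewrite esumZl // p_stochastic mule1.
Qed.

Lemma hit_within_in B n x : B x -> hit_within p B n x = 1.
Proof. by move=> Bx; case: n => [|n] /=; rewrite asboolT. Qed.

Lemma hit_within_notin B n x : ~ B x ->
  hit_within p B n.+1 x = Q (hit_within p B n) x.
Proof. by move=> Bx; rewrite /= asboolF. Qed.

Lemma hit_within0_notin B x : ~ B x -> hit_within p B 0 x = 0.
Proof. by move=> Bx; rewrite /= asboolF. Qed.

Lemma hit_within_ge0 B n x : 0 <= hit_within p B n x.
Proof.
elim: n x => [|n IH] x; have [Bx|Bx] := pselect (B x).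
- by rewrite hit_within_in.
- by rewrite hit_within0_notin.
- by rewrite hit_within_in.
- by rewrite hit_within_notin // esum_ge0 // => y _; rewrite mule_ge0.
Qed.

Lemma hit_within_le1 B n x : hit_within p B n x <= 1.
Proof.
elim: n x => [|n IH] x; have [Bx|Bx] := pselect (B x).
- by rewrite hit_within_in.
- by rewrite hit_within0_notin.
- by rewrite hit_within_in.
- rewrite hit_within_notin // -(p_stochastic x).
  by apply: le_esum => y _; rewrite -[leRHS]mule1 lee_wpmul2l.
Qed.

Lemma hit_within_homo B n x : hit_within p B n x <= hit_within p B n.+1 x.
Proof.
elim: n x => [|n IH] x; have [Bx|Bx] := pselect (B x).
- by rewrite !hit_within_in.
- by rewrite hit_within0_notin // hit_within_ge0.
- by rewrite !hit_within_in.
- by rewrite !hit_within_notin // step_le // => y; exact: hit_within_ge0.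
Qed.

Lemma hit_within_subset A B n x : A `<=` B ->
  hit_within p A n x <= hit_within p B n x.
Proof.
move=> AB; elim: n x => [|n IH] x; have [Ax|Ax] := pselect (A x).
- by rewrite !hit_within_in //; exact: AB.
- by rewrite hit_within0_notin // hit_within_ge0.
- by rewrite !hit_within_in //; exact: AB.
have [Bx|Bx] := pselect (B x).
  by rewrite [leRHS]hit_within_in // hit_within_le1.
by rewrite !hit_within_notin // step_le // => y; exact: hit_within_ge0.
Qed.

Lemma hit_within_le_prob B n x : hit_within p B n x <= hit_prob p B x.
Proof. by apply: ereal_sup_ubound; exists n. Qed.

Lemma hit_prob_le1 B x : hit_prob p B x <= 1.
Proof. by apply: ge_ereal_sup => _ [n _ <-]; exact: hit_within_le1. Qed.

Lemma hit_prob_ge0 B x : 0 <= hit_prob p B x.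
Proof. exact: le_trans (hit_within_ge0 B 0 x) (hit_within_le_prob B 0 x). Qed.

Lemma p_fin_num x y : p x y \is a fin_num.
Proof.
rewrite ge0_fin_numE //; apply: (@le_lt_trans _ _ 1); last exact: ltry.
rewrite -(p_stochastic x); apply: esum_ge; exists [set y].
  by split => //; exact: finite_set1.
by rewrite fsbig_set1.
Qed.

(** On a finite set of sites the increasing limit in n commutes with the sum, and each finite
    partial sum at stage n is at most the probability of hitting within n + 1 steps. *)
Lemma step_hit_prob B x : ~ B x -> Q (hit_prob p B) x <= hit_prob p B x.
Proof.
move=> Bx; apply: ge_ereal_sup => _ [X [finX _] <-].
have cv y : hit_within p B n y @[n --> \oo] --> hit_prob p B y.
  apply: ereal_nondecreasing_cvgn; apply/nondecreasing_seqP => n.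
  exact: hit_within_homo.
have : \sum_(y \in X) p x y * hit_within p B n y @[n --> \oo] -->
       \sum_(y \in X) p x y * hit_prob p B y.
  rewrite fsbig_finite //.
  under eq_fun do rewrite fsbig_finite //.
  apply: cvg_nnesum => y _.
    by apply: nearW => n; rewrite mule_ge0 // hit_within_ge0.
  by apply: cvgeZl; [exact: p_fin_num|exact: cv].
move/cvge_to_le; apply; apply: nearW => n.
apply: le_trans (hit_within_le_prob B n.+1 x).
by rewrite hit_within_notin //; apply: esum_ge; exists X.
Qed.

(* By the Markov property, [hit_prob] is at least [h_n + delta (1 - h_n)],
   [h_n] being the probability to hit within [n] steps. *)
Lemma massive_of_lower_bound B (delta : R) : (0 < delta)%R -> (delta <= 1)%R ->
  (forall x, delta%:E <= hit_prob p B x) -> massive p B.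
Proof.
move=> d0 d1 dB.
have key n x : (1 - delta)%:E * hit_within p B n x + delta%:E <= hit_prob p B x.
  elim: n x => [|n IH] x; have [Bx|Bx] := pselect (B x).
  - apply: le_trans (hit_within_le_prob B 0 x).
    by rewrite hit_within_in // mule1 -EFinD subrK.
  - by rewrite hit_within0_notin // mule0 add0e.
  - apply: le_trans (hit_within_le_prob B 0 x).
    by rewrite !hit_within_in // mule1 -EFinD subrK.
  apply: le_trans (step_hit_prob Bx).
  rewrite hit_within_notin // -{1}(step_cst x (ltW d0)).
  rewrite -step_lin ?subr_ge0 //; last 2 first.
  - by move=> y; exact: hit_within_ge0.
  - by move=> y; rewrite lee_fin ltW.
  apply: step_le => // y.
  by rewrite adde_ge0 ?mule_ge0 ?hit_within_ge0 ?lee_fin ?subr_ge0 // ltW.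
move=> x; apply/eqP; rewrite eq_le hit_prob_le1 /=.
have fin : hit_prob p B x \is a fin_num.
  rewrite ge0_fin_numE ?hit_prob_ge0 //.
  by apply: le_lt_trans (hit_prob_le1 B x) _; exact: ltry.
(* The supremum over n in [key]; it says delta <= delta h for the hitting probability h, that is h
   >= 1. *)
have : (1 - delta)%:E * hit_prob p B x + delta%:E <= hit_prob p B x.
  rewrite -leeBrDr // -ereal_supZl ?subr_ge0 //; last first.
    by apply/set0P; exists (hit_within p B 0 x), 0%N.
  apply: ge_ereal_sup => _ [_ [n _ <-] <-].
  by rewrite leeBrDr.
rewrite -(fineK fin) -EFinM -EFinD !lee_fin.
move: (fine _) => h; nra.
Qed.

(* [T n] is meant to bound [P^n V], the part of the potential collected after
   [n] steps. *)
Lemma potential_le_hit A B (V : pt -> \bar R) (T : nat -> pt -> \bar R) (M : R) :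
  (0 <= M)%R -> A `<=` B -> (forall n x, 0 <= T n x) -> (forall x, 0 <= V x) ->
  (forall x, V x <= T 0%N x) ->
  (forall x, A x -> V x <= M%:E) ->
  (forall x, ~ A x -> V x <= Q V x) ->
  (forall n x, Q (T n) x <= T n.+1 x) ->
  forall n x, V x <= M%:E * hit_within p B n x + T n x.
Proof.
move=> M0 AB T0 V0 VT0 VA VQ QT n x.
(* The induction runs on the smaller set [A], where [V] is known to be at most [M]. *)
apply: (@le_trans _ _ (M%:E * hit_within p A n x + T n x)); last first.
  by rewrite leeD2r // lee_wpmul2l // hit_within_subset.
elim: n x => [|n IH] x.
  by apply: le_trans (VT0 x) _; rewrite leeDr // mule_ge0 // hit_within_ge0.
have [Ax|Ax] := pselect (A x).
  by rewrite hit_within_in // mule1; apply: le_trans (VA _ Ax) _; rewrite leeDl.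
apply: le_trans (VQ _ Ax) _; rewrite hit_within_notin //.
apply: (@le_trans _ _ (Q (fun y => M%:E * hit_within p A n y + T n y) x)).
  exact: step_le.
rewrite step_lin // => [|y]; last exact: hit_within_ge0.
by rewrite leeD2l.
Qed.

(* A recurrent set is visited infinitely often, so that no function satisfying
   [V >= 1_B + P V], in particular the expected number of visits, is finite. *)
Lemma massive_potential_infty B (V : pt -> \bar R) : massive p B ->
  (forall x, 0 <= V x) -> (forall x, Q V x <= V x) ->
  (forall x, B x -> 1 + Q V x <= V x) -> forall x, B x -> V x = +oo.
Proof.
move=> mB V0 VQ VB x Bx.
(* Minimum principle: a lower bound on [B] spreads to every starting point, because [B] is hit
   almost surely. *)
have low (m : nat) : (forall y, B y -> m%:R%:E <= V y) -> forall y, m%:R%:E <= V y.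
  move=> h.
  have hn n y : m%:R%:E * hit_within p B n y <= V y.
    elim: n y => [|n IH] y; have [By|By] := pselect (B y).
    - by rewrite hit_within_in // mule1 h.
    - by rewrite hit_within0_notin // mule0.
    - by rewrite hit_within_in // mule1 h.
    rewrite hit_within_notin // -esumZl //; last first.
      by move=> z; rewrite mule_ge0 // hit_within_ge0.
    apply: le_trans (VQ y); apply: le_esum => z _.
    by rewrite muleCA lee_wpmul2l.
  move=> y; rewrite -[leLHS]mule1 -(mB y) -ereal_supZl //; last first.
    by apply/set0P; exists (hit_within p B 0 y), 0%N.
  by apply: ge_ereal_sup => _ [_ [n _ <-] <-].
(* If V >= m everywhere then Q V >= m, and the extra visit gives V >= m + 1 on [B]. *)
have big (m : nat) y : B y -> m%:R%:E <= V y.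
  elim: m y => [|m IH] y By //.
  apply: le_trans (VB _ By); rewrite -natr1 addeC EFinD leeD2r //.
  by rewrite -(step_cst y (ler0n R m)); apply: step_le => // z; exact: low.
apply: eq_infty => r; apply: le_trans (big (Num.bound `|r|) x Bx).
rewrite lee_fin; apply: le_trans (ler_norm r) (ltW _).
exact: archi_boundP.
Qed.
End Hitting.

(** * The Green function of the stable walk *)

Section StableKernel.
Context {R : realType}.
Variable alpha : R.
Hypothesis alpha_ge1 : 1 <= alpha.
Hypothesis alpha_lt2 : alpha < 2.
Local Notation c := (stable_coef alpha).
Local Notation g := (green_coef (alpha / 2)).
Local Notation p := (stable_kernel alpha).
Implicit Types (f : pt -> R) (x y : pt) (k n m : nat).

(** [P] acting on functions as a finite average, so that its iterates stay real-valued for every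
    [f], even of infinite support. *)
Definition srw_op f x : R :=
  4^-1 * (f (ptadd x (1, 0)) + f (ptadd x (-1, 0)) + f (ptadd x (0, 1))
          + f (ptadd x (0, -1))).

Lemma srw_iter_ge0 f n x : (forall y, 0 <= f y) -> 0 <= iter n srw_op f x.
Proof.
move=> f0; elim: n x => //= n IH x.
by rewrite /srw_op mulr_ge0 ?invr_ge0 // !addr_ge0.
Qed.

Lemma srw_iter_cst n r x : iter n srw_op (fun=> r) x = r.
Proof. by elim: n x => //= n IH x; rewrite /srw_op !IH; field. Qed.

Lemma srw_iter_sum (I : Type) (s : seq I) (F : I -> pt -> R) n x :
  iter n srw_op (fun z => \sum_(i <- s) F i z) x =
  \sum_(i <- s) iter n srw_op (F i) x.
Proof.
elim: n x => //= n IH x; rewrite /srw_op !IH -!big_split /= mulr_sumr.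
by [].
Qed.

Lemma srw_pow_iter n x y : srw_pow R n x y = iter n srw_op (fun z => (z == y)%:R) x.
Proof. by elim: n x => //= n IH x; rewrite !IH. Qed.

Lemma esum_srw_pow n f x : (forall y, 0 <= f y) ->
  (\esum_(y in [set: pt]) (srw_pow R n x y * f y)%:E = (iter n srw_op f x)%:E)%E.
Proof.
move=> f0; elim: n x => [|n IH] x.
  rewrite /= -[RHS](esum_set1 (a := fun y => (f y)%:E)) ?lee_fin //.
  rewrite [RHS]esum_mkcond; apply: eq_esum => y _.
  have [->|xy] := eqVneq x y; first by rewrite mul1r mem_set.
  by rewrite mul0r memNset //= => /esym/eqP; rewrite (negbTE xy).
have T0 z y : (0 <= (srw_pow R n z y * f y)%:E)%E.
  by rewrite lee_fin mulr_ge0 // srw_pow_ge0.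
rewrite /= /srw_op EFinM !EFinD -!IH -!esumD //; last 2 first.
- by move=> y _; rewrite !adde_ge0.
- by move=> y _; rewrite !adde_ge0.
rewrite -esumZl ?invr_ge0 //; last by move=> y; rewrite !adde_ge0.
apply: eq_esum => y _; rewrite -!EFinD -EFinM; congr EFin.
by rewrite -!mulrDl mulrA.
Qed.

Let alpha0 : 0 <= alpha. Proof. by apply: le_trans alpha_ge1. Qed.

Lemma stable_coefS_ge0 k : 0 <= c k.+1.
Proof. by apply: stable_coef_ge0 => //; exact: ltW. Qed.

Lemma stable_kernelE x y :
  (p x y = \sum_(k <oo) (c k.+1 * srw_pow R k.+1 x y)%:E)%E.
Proof.
rewrite /stable_kernel.
pose u k := (c k * srw_pow R k x y)%:E.
(* Since c_0 = -1, the term [u 0] can be negative; setting it to 0 allows reindexing as a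
   nonnegative series. *)
pose v k := if k is 0%N then 0%E else u k.
have <- : (\sum_(1 <= k <oo) v k = \sum_(1 <= k <oo) u k)%E.
  rewrite eseries_cond [RHS]eseries_cond; apply: eq_eseriesr => -[|k] //=.
rewrite -(nneseries_addn (f := v)) //.
  by apply: eq_eseriesr => k _; rewrite addn1.
case=> // k; rewrite /v /u lee_fin mulr_ge0 ?srw_pow_ge0 //.
exact: stable_coefS_ge0.
Qed.

Lemma stable_kernel_ge0 x y : (0 <= p x y)%E.
Proof.
rewrite stable_kernelE; apply: nneseries_ge0 => k _ _.
by rewrite lee_fin mulr_ge0 ?srw_pow_ge0 // stable_coefS_ge0.
Qed.

Lemma stable_kernel_step f x : (forall y, 0 <= f y) ->
  (\esum_(y in [set: pt]) (p x y * (f y)%:E) =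
   \sum_(k <oo) (c k.+1 * iter k.+1 srw_op f x)%:E)%E.
Proof.
move=> f0.
transitivity (\esum_(y in [set: pt])
    \sum_(k <oo) (c k.+1 * (srw_pow R k.+1 x y * f y))%:E)%E.
  apply: eq_esum => y _; rewrite stable_kernelE muleC -nneseriesZl.
    by apply: eq_eseriesr => k _; rewrite -EFinM; congr EFin; ring.
  by move=> k _; rewrite lee_fin mulr_ge0 ?srw_pow_ge0 // stable_coefS_ge0.
rewrite esum_nneseries; last first.
  move=> y k; rewrite lee_fin; apply: mulr_ge0 (stable_coefS_ge0 _) _.
  by rewrite mulr_ge0 ?srw_pow_ge0.
apply: eq_eseriesr => k _; rewrite EFinM -esum_srw_pow // -esumZl //.
  exact: stable_coefS_ge0.
by move=> y; rewrite lee_fin mulr_ge0 ?srw_pow_ge0.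
Qed.

Lemma stable_kernel_stochastic x : (\esum_(y in [set: pt]) p x y = 1)%E.
Proof.
have -> : (\esum_(y in [set: pt]) p x y =
           \esum_(y in [set: pt]) (p x y * 1%:E))%E.
  by apply: eq_esum => y _; rewrite mule1.
rewrite (@stable_kernel_step (fun=> 1)) //.
transitivity (\sum_(k <oo) (c k.+1)%:E)%E.
  by apply: eq_eseriesr => k _; rewrite srw_iter_cst mulr1.
have c0 k : (0 <= (c k.+1)%:E)%E by rewrite lee_fin stable_coefS_ge0.
have part n : (\sum_(0 <= k < n) (c k.+1)%:E = (\sum_(k < n) c k.+1)%:E)%E.
  by rewrite big_mkord sumEFin.
have tail n := stable_coef_tail n alpha_ge1 (ltW alpha_lt2).
apply/eqP; rewrite eq_le; apply/andP; split.
  apply: lime_le; first exact: is_cvg_nneseries.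
  apply: nearW => n; rewrite part lee_fin.
  by have [+ _] := tail n; rewrite subr_ge0.
apply/lee_addgt0Pr => e e0.
(* [stable_coef_tail] bounds the square of the missing mass by 1 / (n + 1), which is at most e^2 for
   this n. *)
pose n := Num.bound (e ^- 2).
apply: (@le_trans _ _ ((\sum_(k < n) c k.+1)%:E + e%:E)%E); last first.
  by rewrite leeD2r // -part; exact: nneseries_lim_ge.
rewrite -EFinD lee_fin addrC -lerBlDr.
have [t0 t1] := tail n.
rewrite -(@ler_pXn2r _ 2) ?nnegrE ?(ltW e0) //.
have e2 : 0 < e ^+ 2 by rewrite exprn_gt0.
have : e ^- 2 <= n.+1%:R.
  apply: le_trans (ltW (archi_boundP _)) _; first by rewrite invr_ge0 ltW.
  by rewrite ler_nat.
rewrite -(ler_pM2l e2) divff ?gt_eqF // => h.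
have n1 : 0 < n.+1%:R :> R by rewrite ltr0n.
by rewrite -(ler_pM2r n1); apply: le_trans t1 h.
Qed.

(** Composing the two power series in [P] convolves their coefficients, by Tonelli. General weights
    [w] cover the truncated Green coefficients as well. *)
Lemma stable_kernel_series (w : nat -> R) f (t : pt -> R) x :
  (forall k, 0 <= w k) -> (forall y, 0 <= f y) ->
  (forall y, (\sum_(k <oo) (w k * iter k srw_op f y)%:E = (t y)%:E)%E) ->
  (\esum_(y in [set: pt]) (p x y * (t y)%:E) =
   \sum_(n <oo) ((\sum_(k < n) c k.+1 * w (n - k.+1)%N) * iter n srw_op f x)%:E)%E.
Proof.
move=> w0 f0 tE.
have P0 k y : 0 <= iter k srw_op f y by exact: srw_iter_ge0.
have t0 y : 0 <= t y.
  by rewrite -lee_fin -tE; apply: nneseries_ge0 => k _ _; rewrite lee_fin mulr_ge0.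
rewrite stable_kernel_step //.
(* Each shifted series is padded with zeros up to index k, so that the double sum runs over all
   pairs and can be interchanged. *)
have inner k : ((c k.+1 * iter k.+1 srw_op t x)%:E =
    \sum_(n <oo) (if (k < n)%N then c k.+1 * w (n - k.+1)%N * iter n srw_op f x else 0)%:E)%E.
  pose v n := (if (k < n)%N then c k.+1 * w (n - k.+1)%N * iter n srw_op f x else 0)%:E.
  have v0 n : (0 <= v n)%E.
    rewrite /v lee_fin; case: ifP => // _; rewrite -mulrA.
    by apply: mulr_ge0 (stable_coefS_ge0 _) _; rewrite mulr_ge0.
  have -> : (\sum_(n <oo) v n = \sum_(n <oo) v (n + k.+1)%N)%E.
    rewrite nneseries_addn // (nneseries_split 0 k.+1) // add0n.
    rewrite big_nat big1 ?add0e // => i /andP[_ ik].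
    by rewrite /v ltnNge -ltnS ik.
  rewrite EFinM -esum_srw_pow //.
  transitivity ((c k.+1)%:E * \sum_(n <oo) (w n * iter (n + k.+1) srw_op f x)%:E)%E.
    congr (_ * _)%E.
    transitivity (\esum_(y in [set: pt]) \sum_(n <oo)
       (srw_pow R k.+1 x y * (w n * iter n srw_op f y))%:E)%E.
      apply: eq_esum => y _; rewrite EFinM -tE -nneseriesZl.
        by apply: eq_eseriesr => n _; rewrite -EFinM.
      by move=> n _; rewrite lee_fin mulr_ge0.
    rewrite esum_nneseries; last first.
      move=> y n; rewrite lee_fin.
      by apply: mulr_ge0; [exact: srw_pow_ge0|exact: mulr_ge0].
    apply: eq_eseriesr => n _; rewrite EFinM addnC iterD -esum_srw_pow //.
    rewrite -esumZl //; last by move=> y; rewrite lee_fin mulr_ge0 ?srw_pow_ge0.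
    by apply: eq_esum => y _; rewrite -EFinM mulrCA.
  rewrite -nneseriesZl; last by move=> n _; rewrite lee_fin mulr_ge0.
  apply: eq_eseriesr => n _; rewrite /v ifT ?addnK; last by rewrite addnS ltnS leq_addl.
  by rewrite -EFinM mulrA.
under eq_eseriesr do rewrite inner.
rewrite nneseries_interchange; last first.
  move=> k n; rewrite lee_fin; case: ifP => // _; rewrite -mulrA.
  by apply: mulr_ge0 (stable_coefS_ge0 _) _; rewrite mulr_ge0.
apply: eq_eseriesr => n _.
rewrite (nneseries_split 0 n); last first.
  move=> k _; rewrite lee_fin; case: ifP => // _; rewrite -mulrA.
  by apply: mulr_ge0 (stable_coefS_ge0 _) _; rewrite mulr_ge0.
rewrite add0n [X in (_ + X)%E]eseries_cond eseries0 ?adde0; last first.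
  by move=> k _ /= nk; rewrite ltnNge nk.
rewrite sumEFin big_mkord mulr_suml; congr EFin.
by apply: eq_bigr => -[k kn] _ /=; rewrite kn.
Qed.

(** * Potentials of the stable walk and their tails *)

Let a_ge : 2^-1 <= alpha / 2. Proof. by rewrite ler_pdivlMr // mulVf. Qed.
Let a_lt : alpha / 2 < 1. Proof. by rewrite ltr_pdivrMr // mul1r. Qed.
Let a_gt0 : 0 < alpha / 2. Proof. by apply: lt_le_trans a_ge; rewrite invr_gt0. Qed.
Let g_ge0 n : 0 <= g n. Proof. by rewrite ltW // green_coef_gt0. Qed.
Let p_ge0 := stable_kernel_ge0.
Let p_sto := stable_kernel_stochastic.

(** For N = 0 this is the potential G f. Truncation is done by zero weights rather than by the
    summation range, to fit [stable_kernel_series]. *)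
Definition green_tail N f x : \bar R :=
  (\sum_(k <oo) ((if (N <= k)%N then g k else 0) * iter k srw_op f x)%:E)%E.

Section GreenTail.
Variable f : pt -> R.
Hypothesis f_ge0 : forall y, 0 <= f y.
Hypothesis f_fin : forall y, (green_tail 0 f y < +oo)%E.

Let P0 k y : 0 <= iter k srw_op f y. Proof. exact: srw_iter_ge0. Qed.
Let w_ge0 N k : 0 <= (if (N <= k)%N then g k else 0). Proof. by case: ifP. Qed.

Lemma green_tail_ge0 N x : (0 <= green_tail N f x)%E.
Proof. by apply: nneseries_ge0 => k _ _; rewrite lee_fin mulr_ge0. Qed.

Lemma green_tail_fin N x : green_tail N f x = (fine (green_tail N f x))%:E.
Proof.
rewrite fineK // ge0_fin_numE ?green_tail_ge0 //; apply: le_lt_trans (f_fin x).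
apply: lee_nneseries => k _; first by rewrite lee_fin mulr_ge0.
by rewrite lee_fin ler_wpM2r //=; case: ifP.
Qed.

Lemma green_tail_step N x :
  (\esum_(y in [set: pt]) (stable_kernel alpha x y * green_tail N f y) =
   \sum_(n <oo) ((\sum_(k < n) c k.+1 * (if (N <= n - k.+1)%N then g (n - k.+1) else 0))
      * iter n srw_op f x)%:E)%E.
Proof.
under eq_esum do rewrite green_tail_fin.
rewrite (@stable_kernel_series (fun k => if (N <= k)%N then g k else 0) f) //.
by move=> y; rewrite -green_tail_fin.
Qed.

(** For n > N, removing the truncation raises the convolution to g_n by [green_coef_renewal]; for n
    <= N all its terms vanish. This makes the tails admissible as [T] in [potential_le_hit]. *)
Lemma green_tail_step_le N x :
  (\esum_(y in [set: pt]) (stable_kernel alpha x y * green_tail N f y) <=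
   green_tail N.+1 f x)%E.
Proof.
rewrite green_tail_step; apply: lee_nneseries => n _.
  rewrite lee_fin mulr_ge0 // sumr_ge0 // => k _.
  exact: mulr_ge0 (stable_coefS_ge0 _) _.
rewrite lee_fin ler_wpM2r //; case: ifP => [|/negbT]; last first.
  rewrite -leqNgt => nN; rewrite big1 // => k _.
  by rewrite ifF ?mulr0 //; have := ltn_ord k; lia.
case: n => // n _; rewrite -green_coef_renewal; apply: ler_sum => k _.
apply: ler_wpM2l; first exact: stable_coefS_ge0.
by rewrite subSS; case: ifP.
Qed.

(** The term n = 0 gives [f] because g_0 = 1; the other coefficients agree by
    [green_coef_renewal]. *)
Lemma green_step x : (green_tail 0 f x =
  (f x)%:E + \esum_(y in [set: pt]) (stable_kernel alpha x y * green_tail 0 f y))%E.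
Proof.
rewrite green_tail_step /green_tail (nneseries_split 0 1); last first.
  by move=> k _; rewrite lee_fin mulr_ge0.
rewrite add0n big_nat1 /= mul1r; congr (_ + _)%E.
rewrite [RHS](nneseries_split 0 1); last first.
  move=> n _; rewrite lee_fin mulr_ge0 // sumr_ge0 // => k _.
  exact: mulr_ge0 (stable_coefS_ge0 _) _.
rewrite add0n big_nat1 big_ord0 mul0r add0e.
rewrite eseries_cond [RHS]eseries_cond; apply: eq_eseriesr => -[//|n] _ /=.
by congr (_ * _)%:E; rewrite -green_coef_renewal; apply: eq_bigr => k _; rewrite subSS.
Qed.

Lemma green_tail_cvg x : green_tail N f x @[N --> \oo] --> 0%E.
Proof.
have G0 k : (0 <= (g k * iter k srw_op f x)%:E)%E by rewrite lee_fin mulr_ge0.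
have -> : (fun N => green_tail N f x) =
    (fun N => \sum_(N <= k <oo) (g k * iter k srw_op f x)%:E)%E.
  apply/funext => N; rewrite /green_tail (nneseries_split 0 N); last first.
    by move=> k _; rewrite lee_fin mulr_ge0.
  rewrite add0n big_nat big1 ?add0e; last first.
    by move=> i /andP[_ iN]; rewrite leqNgt iN mul0r.
  rewrite eseries_cond [RHS]eseries_cond; apply: eq_eseriesr => k.
  by move=> /= ->.
apply: nneseries_tail_cvg => //; have := f_fin x; rewrite /green_tail.
by [].
Qed.
End GreenTail.

(** * The Green function and its use for hitting probabilities *)

Definition green x y : \bar R := (\sum_(k <oo) (g k * srw_pow R k x y)%:E)%E.
Local Notation phi r := (g (r ^ 2)%N).
Local Notation C := (9 / (alpha / 2) + (1 - alpha / 2)^-1).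

Lemma green_le x y : (green x y <= (C * phi (pdist x y))%:E)%E.
Proof.
apply: lime_le.
  by apply: is_cvg_nneseries => k _ _; rewrite lee_fin mulr_ge0 ?srw_pow_ge0.
by apply: nearW => n; rewrite sumEFin lee_fin green_partial_le.
Qed.

Lemma green_ge x y : ((phi (pdist x y) / 1152)%:E <= green x y)%E.
Proof.
have [M h] := green_partial_ge x y a_ge a_lt.
apply: (@le_trans _ _ (\sum_(0 <= n < M) (g n * srw_pow R n x y)%:E)%E).
  by rewrite sumEFin lee_fin.
by apply: nneseries_lim_ge => k _ _; rewrite lee_fin mulr_ge0 ?srw_pow_ge0.
Qed.

Lemma green_ge0 x y : (0 <= green x y)%E.
Proof. by apply: nneseries_ge0 => k _ _; rewrite lee_fin mulr_ge0 ?srw_pow_ge0. Qed.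

Lemma green_tail_sum (I : Type) (s : seq I) (b : I -> pt) x :
  (green_tail 0 (fun z => (\sum_(i <- s) (z == b i)%:R)%R) x = \sum_(i <- s) green x (b i))%E.
Proof.
rewrite -nneseries_sum; last by move=> i k _; rewrite lee_fin mulr_ge0 ?srw_pow_ge0.
apply: eq_eseriesr => k _; rewrite /= sumEFin srw_iter_sum mulr_sumr.
by congr EFin; apply: eq_bigr => i _; rewrite srw_pow_iter.
Qed.

Lemma green_tail_indic (B : set pt) x :
  (green_tail 0 (fun z => (z \in B)%:R%R) x = \esum_(y in B) green x y)%E.
Proof.
rewrite esum_nneseries; last by move=> y k; rewrite lee_fin mulr_ge0 ?srw_pow_ge0.
apply: eq_eseriesr => k _; rewrite EFinM -esum_srw_pow; last by move=> y; rewrite ler0n.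
rewrite -esumZl //; last by move=> y; rewrite lee_fin mulr_ge0 ?srw_pow_ge0.
rewrite [RHS]esum_mkcond; apply: eq_esum => y _.
by case: ifP => _; rewrite -EFinM ?mulr1 ?mulr0.
Qed.

(** Maximum principle for the potential of [f], which counts the points [b i] with multiplicity: off
    these points it is harmonic by [green_step], on them it is at most [M], and the remainder
    [green_tail n] tends to 0. *)
Lemma green_sum_le_hit_prob (I : eqType) (s : seq I) (b : I -> pt) (A : set pt) (M : R) x :
  (forall i, i \in s -> A (b i)) ->
  (forall i, i \in s -> (\sum_(j <- s) green (b i) (b j) <= M%:E)%E) -> 0 <= M ->
  (\sum_(i <- s) green x (b i) <= M%:E * hit_prob (stable_kernel alpha) A x)%E.
Proof.
move=> bA bM M0; pose f z : R := \sum_(i <- s) (z == b i)%:R.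
have f0 z : 0 <= f z by rewrite sumr_ge0.
have f_fin z : (green_tail 0 f z < +oo)%E.
  rewrite green_tail_sum; apply: lte_sum_pinfty => i _.
  by apply: le_lt_trans (green_le _ _) _; rewrite ltry.
pose F := [set b i | i in [set i | i \in s]].
have key n : (green_tail 0 f x <= M%:E * hit_within (stable_kernel alpha) A n x
                                 + green_tail n f x)%E.
  apply: (@potential_le_hit _ _ p_ge0 p_sto F A _ (fun n => green_tail n f)) => //.
  - by move=> _ [i /= si <-]; exact: bA.
  - by move=> m z; exact: green_tail_ge0.
  - by move=> z; exact: green_tail_ge0.
  - by move=> _ [i /= si <-]; rewrite green_tail_sum bM.
  - move=> z Fz; rewrite {1}green_step // /f big_seq big1 ?add0e // => i si.
    by case: eqP => // zi; exfalso; apply: Fz; exists i.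
  - by move=> m z; exact: green_tail_step_le.
rewrite -green_tail_sum -/f.
have h_fin : (M%:E * hit_prob (stable_kernel alpha) A x)%E \is a fin_num.
  rewrite fin_numM // ge0_fin_numE ?hit_prob_ge0 //.
  by apply: le_lt_trans (hit_prob_le1 p_ge0 p_sto A x) _; exact: ltry.
have cv : (M%:E * hit_prob (stable_kernel alpha) A x + green_tail N f x)%E
    @[N --> \oo] --> (M%:E * hit_prob (stable_kernel alpha) A x + 0)%E.
  apply: cvgeD; first by rewrite fin_num_adde_defr.
    exact: cvg_cst.
  exact: green_tail_cvg.
rewrite -[leRHS]adde0; apply: (cvge_to_ge cv); apply: nearW => n.
apply: le_trans (key n) _; rewrite leeD2r // lee_wpmul2l ?lee_fin //.
exact: hit_within_le_prob.
Qed.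

Lemma not_massive_of_green (B : set pt) :
  (forall x, \esum_(y in B) green x y < +oo)%E -> ~ massive (stable_kernel alpha) B.
Proof.
move=> Bfin mB; pose f z : R := (z \in B)%:R.
have f0 z : 0 <= f z by rewrite ler0n.
have f_fin z : (green_tail 0 f z < +oo)%E by rewrite green_tail_indic.
have p0 := stable_kernel_ge0; have p1 := stable_kernel_stochastic.
(* The empty set has hitting probability 0, so a massive set has a point at which the potential can
   be evaluated. *)
have [b Bb] : exists b, B b.
  apply: contrapT => nB; have B0 x : ~ B x by move=> Bx; apply: nB; exists x.
  have h0 n x : hit_within (stable_kernel alpha) B n x = 0%E.
    elim: n x => [|n IH] x; first by rewrite hit_within0_notin.
    by rewrite hit_within_notin // esum1 // => y _; rewrite IH mule0.
  have : (hit_prob (stable_kernel alpha) B (0, 0)%R <= 0)%E.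
    by apply: ge_ereal_sup => _ [n _ <-]; rewrite h0.
  by rewrite mB lee_fin ler10.
have Voo : green_tail 0 f b = +oo%E.
  apply: (massive_potential_infty p0 p1 mB) => // [x|x|x Bx].
  - exact: green_tail_ge0.
  - by rewrite [leRHS]green_step // leeDr ?lee_fin.
  - by rewrite [leRHS]green_step // /f mem_set.
by have := f_fin b; rewrite Voo ltxx.
Qed.
(** Moving the starting point by d changes the Green bound by a constant factor only: for s < r,
    [green_coef_doubling] reduces this to (s + d)^2 + 1 <= (2 + 2 d^2)(s^2 + 1). *)
Lemma green_coef_sq_doubling (r s d : nat) : (r <= s + d)%N ->
  phi s <= (2 + 2 * d ^ 2)%N%:R * phi r.
Proof.
move=> rsd; have [rs|sr] := leqP r s.
  apply: (@le_trans _ _ (phi r)).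
    by apply: green_coef_anti => //; [exact: ltW|rewrite leq_exp2r].
  by rewrite ler_peMl // ler1n.
have sr2 : (s ^ 2 <= r ^ 2)%N by rewrite leq_exp2r // ltnW.
have s0 : 0 < (s ^ 2).+1%:R :> R by rewrite ltr0n.
rewrite -(ler_pM2l s0); apply: le_trans (green_coef_doubling a_ge sr2) _.
rewrite mulrA ler_wpM2r // -natrM ler_nat.
have : (r ^ 2 <= (s + d) ^ 2)%N by rewrite leq_exp2r.
by nia.
Qed.

Lemma green_coef_sq_double (r : nat) : phi r <= 4 * phi r.*2.
Proof.
have r2 : (r ^ 2 <= r.*2 ^ 2)%N by rewrite leq_exp2r //; lia.
have s0 : 0 < (r ^ 2).+1%:R :> R by rewrite ltr0n.
rewrite -(ler_pM2l s0); apply: le_trans (green_coef_doubling a_ge r2) _.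
by rewrite mulrA ler_wpM2r // -natrM ler_nat; nia.
Qed.

Lemma green_coef_sq_powR (r : nat) : (0 < r)%N ->
  phi r <= (r%:R `^ (2 - alpha))^-1 <= 2 * phi r.
Proof.
move=> r0; have r2 : (0 < r ^ 2)%N by rewrite expn_gt0 r0.
have /andP[lo up] := green_coef_powR a_ge a_lt r2.
have e : (r ^ 2)%N%:R `^ (1 - alpha / 2) = r%:R `^ (2 - alpha).
  rewrite natrX -powR_mulrn // -powRrM; congr (_ `^ _).
  by field.
move: lo up; rewrite e => lo ->; rewrite andTb; move: lo; lra.
Qed.

Lemma esum_powR_finite (A : set pt) :
  (\esum_(a in A `\` [set ((0%R : int), (0%R : int))])
     (((supnorm a)%:R `^ (2 - alpha))^-1)%:E < +oo)%E ->
  forall x, (\esum_(y in A) green x y < +oo)%E.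
Proof.
move=> Afin x; set o : pt := (0, 0).
pose K := (2 + 2 * supnorm x ^ 2)%N%:R * C.
have C0 : 0 <= C.
  by rewrite addr_ge0 ?divr_ge0 ?invr_ge0 ?(ltW a_gt0) // subr_ge0 ltW.
have K0 : 0 <= K by rewrite mulr_ge0.
have bound y : (green x y <= (K * phi (supnorm y))%:E)%E.
  apply: le_trans (green_le _ _) _; rewrite lee_fin /K mulrAC mulrC ler_wpM2r //.
  apply: green_coef_sq_doubling.
  by case: x {K K0} => x1 x2; case: y => y1 y2; rewrite /pdist /supnorm /=; lia.
(* The origin, absent from the assumed sum, contributes one finite Green term. *)
rewrite (esumID [set o]); last by move=> y _; exact: green_ge0.
apply: lte_add_pinfty.
  rewrite esum_mkcondl esum_set1; last by case: ifP => // _; exact: green_ge0.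
  case: ifP => _; last exact: ltry.
  by apply: le_lt_trans (bound _) _; exact: ltry.
apply: (@le_lt_trans _ _ (K%:E * \esum_(a in A `\` [set o])
     (((supnorm a)%:R `^ (2 - alpha))^-1)%:E)%E).
  rewrite -esumZl //; apply: le_esum => y [_ yo]; apply: le_trans (bound _) _.
  rewrite -EFinM lee_fin ler_wpM2l //.
  have y0 : (0 < supnorm y)%N.
    rewrite lt0n; apply: contra_not_neq yo => /=.
    by case: y => y1 y2; rewrite /supnorm /o /= => h; congr (_, _); lia.
  by have /andP[] := green_coef_sq_powR y0.
by rewrite lte_mul_pinfty // lee_fin.
Qed.
End StableKernel.

(** * Superlinear sets *)

Section ShellSums.
Context {R : realType}.
Implicit Types (h : nat -> R) (A : set pt).

(** The argument of [h] is |i - j|, written with truncated subtractions; each value is taken at most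
    twice as j varies. *)
Lemma sum_dist_le h (n i : nat) : (forall m, 0 <= h m) -> (i < n)%N ->
  \sum_(0 <= j < n) h ((i - j) + (j - i))%N <= 2 * \sum_(0 <= m < n) h m.
Proof.
move=> h0 i_n; rewrite (big_cat_nat _ (n := i.+1)) //= mulr_natl mulr2n lerD //.
  rewrite big_nat_rev /= add0n.
  rewrite (eq_big_nat _ _ (F2 := h)); last by move=> j ji; congr h; lia.
  rewrite [leRHS](big_cat_nat _ (n := i.+1)) //= lerDl sumr_ge0 //.
rewrite -{1}(add0n i.+1) big_addn.
rewrite (eq_big_nat _ _ (F2 := fun j => h j.+1)); last by move=> j ji; congr h; lia.
rewrite [leRHS](big_cat_nat _ (n := (n - i.+1).+1)) //=; last by lia.
rewrite [X in _ <= X + _]big_nat_recl // -addrA addrCA lerDl.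
by rewrite addr_ge0 // sumr_ge0.
Qed.

Variables (A : set pt) (L : option nat) (e : nat -> nat) (N : nat).
Hypothesis norms_e : norms A = e @` [set n | idx_ok L n].
Hypothesis A_bounded : forall r : nat, (0 < r)%N ->
  forall s : seq pt, uniq s ->
    (forall a, a \in s -> A a /\ supnorm a = r) -> (size s <= N)%N.

Lemma idx_okW (m n : nat) : idx_ok L n -> (0 < m)%N -> (m <= n)%N -> idx_ok L m.
Proof.
rewrite /idx_ok => /andP[_]; case: L => [l|] //= nl m0 mn; rewrite ?m0 //=.
exact: leq_trans nl.
Qed.

Lemma exists_common_index (s : seq pt) : (forall a, a \in s -> A a) ->
  exists2 n, (n = 0 \/ idx_ok L n)%N &
    forall a, a \in s -> exists2 j, (0 < j <= n)%N & e j = supnorm a.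
Proof.
elim: s => [|a s IH] sA; first by exists 0%N; [left|].
have [|n nok ns] := IH; first by move=> b bs; apply: sA; rewrite inE bs orbT.
have : norms A (supnorm a) by exists a => //; apply: sA; rewrite inE eqxx.
rewrite norms_e => -[j /= jok ej].
have j0 : (0 < j)%N by case/andP: jok.
exists (maxn n j).
  by rewrite /maxn; case: ltnP => // _; right.
move=> b; rewrite inE => /predU1P[->|/ns[k /andP[k0 kn] ek]].
  by exists j => //; rewrite j0 leq_maxr.
by exists k => //; rewrite k0 leq_max kn.
Qed.

(** A shell of positive norm has at most [N] points, so a bound K on all shell sums would bound the
    sum over [A] by c N K. Requiring valid indices up to n treats finite and infinite enumerations
    alike. *)
Lemma shell_sum_unbounded (h : nat -> R) (phi : pt -> R) (c : R) : 0 <= c ->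
  (forall r, 0 <= h r) ->
  (forall a, (0 < supnorm a)%N -> phi a <= c * h (supnorm a)) ->
  (\esum_(a in A `\` [set ((0%R : int), (0%R : int))]) (phi a)%:E = +oo)%E ->
  forall K : R, exists2 n, (forall j, (0 < j <= n)%N -> idx_ok L j) &
    K < \sum_(1 <= j < n.+1) h (e j).
Proof.
move=> c0 h0 phih Aoo K; apply: contrapT => no.
have bounded n : (n = 0 \/ idx_ok L n)%N -> \sum_(1 <= j < n.+1) h (e j) <= K.
  move=> nok; rewrite leNgt; apply/negP => Kn; apply: no; exists n => // j.
  by case: nok => [->|nok] /andP[j0 jn]; [lia|exact: idx_okW jn].
suff : (\esum_(a in A `\` [set ((0%R : int), (0%R : int))]) (phi a)%:E <= (c * (N%:R * K))%:E)%E.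
  by rewrite Aoo leye_eq.
apply: ge_ereal_sup => _ [X [finX XA] <-].
rewrite fsbig_finite // sumEFin lee_fin.
set s := finmap.enum_fset _.
have us : uniq s by exact: finmap.fset_uniq.
have sX a : a \in s -> A a /\ (0 < supnorm a)%N.
  rewrite in_fset_set // inE => /XA[Aa a0]; split => //.
  rewrite lt0n; apply: contra_not_neq a0 => /=.
  by case: a {Aa} => y1 y2; rewrite /supnorm /= => ?; congr (_, _); lia.
have [n nok ns] : exists2 n, (n = 0 \/ idx_ok L n)%N &
    forall a, a \in s -> exists2 j, (0 < j <= n)%N & e j = supnorm a.
  by apply: exists_common_index => a /sX[].
apply: (@le_trans _ _ (c * \sum_(a <- s) h (supnorm a))).
  rewrite mulr_sumr big_seq [leRHS]big_seq; apply: ler_sum => a /sX[_].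
  exact: phih.
rewrite ler_wpM2l //.
apply: le_trans (_ : N%:R * \sum_(1 <= j < n.+1) h (e j) <= _); last first.
  by rewrite ler_wpM2l // bounded.
apply: (@le_trans _ _ (\sum_(a <- s) \sum_(1 <= j < n.+1) (e j == supnorm a)%:R * h (e j))).
  rewrite big_seq [leRHS]big_seq; apply: ler_sum => a /ns[j /andP[j0 jn] ej].
  rewrite (big_cat_nat _ (n := j)) //; last exact: leqW.
  rewrite [X in _ <= _ + X]big_ltn // ej eqxx mul1r.
  apply: ler_wpDl; first by apply: sumr_ge0 => k _; rewrite mulr_ge0.
  by rewrite lerDl; apply: sumr_ge0 => k _; rewrite mulr_ge0.
rewrite exchange_big /= mulr_sumr; apply: ler_sum_nat => j _.
rewrite -mulr_suml ler_wpM2r //.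
(* Radial boundedness speaks of positive radii only; a shell of norm 0 contributes nothing since the
   origin has been removed. *)
have [ej|ej] := posnP (e j).
  rewrite big_seq big1 // => a /sX[_ a0].
  by rewrite ej eq_sym (negbTE (lt0n_neq0 a0)).
rewrite -natr_sum ler_nat -big_mkcond sum1_count -size_filter.
apply: (A_bounded ej); first exact: filter_uniq.
by move=> a; rewrite mem_filter => /andP[/eqP -> /sX[]].
Qed.
End ShellSums.

(** * Potentials of one point per shell *)

Section Superlinear.
Context {R : realType}.
Variables (A : set pt) (L : option nat) (e : nat -> nat) (n : nat).
Hypothesis e_mono : forall i j, idx_ok L i -> idx_ok L j -> (i < j)%N -> (e i < e j)%N.
Hypothesis e_norms : norms A = e @` [set n | idx_ok L n].
Hypothesis e_superadd : forall n k, idx_ok L n -> (0 < k)%N -> (k < n)%N ->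
  (e (n - k)%N + e k <= e n)%N.
Hypothesis n_ok : forall j, (0 < j <= n)%N -> idx_ok L j.

Lemma shell_points : exists a : nat -> pt,
  forall j, (j < n)%N -> A (a j) /\ supnorm (a j) = e j.+1.
Proof.
have /choice[a ha] : forall j, exists x : pt, (j < n)%N -> A x /\ supnorm x = e j.+1.
  move=> j; have [jn|nj] := ltnP j n; last by exists (0, 0).
  have : norms A (e j.+1) by rewrite e_norms; exists j.+1 => //; exact: n_ok.
  by case=> x Ax ex; exists x.
by exists a.
Qed.

Lemma index_le_shell j : (j < n)%N -> (j <= e j.+1)%N.
Proof.
elim: j => // j IH jn; apply: leq_ltn_trans (IH (ltnW jn)) _.
by apply: e_mono => //; apply: n_ok; lia.
Qed.

Lemma shell_gap i j : (i < n)%N -> (j < i)%N -> (e (i - j) <= e i.+1 - e j.+1)%N.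
Proof.
move=> ni ji; have := @e_superadd i.+1 j.+1 _ isT ji; rewrite subSS.
by move=> /(_ (n_ok _)); rewrite ni => /(_ isT); lia.
Qed.

Lemma shell_potential_le (h : nat -> R) (a : nat -> pt) i :
  (forall r, 0 <= h r <= 1) -> (forall r s, (r <= s)%N -> h s <= h r) ->
  (forall j, (j < n)%N -> supnorm (a j) = e j.+1) -> (i < n)%N ->
  \sum_(0 <= j < n) h (pdist (a i) (a j)) <= 2 * (1 + \sum_(1 <= j < n.+1) h (e j)).
Proof.
move=> h01 h_anti ea i_n; have h0 r : 0 <= h r by have /andP[] := h01 r.
(* Shells are numbered from 1, so [e 0] carries no information; the value 1 at 0 bounds the diagonal
   term. *)
pose h' m := if m is 0%N then 1 else h (e m).
have h'0 m : 0 <= h' m by case: m => [|m]; [exact: ler01|exact: h0].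
apply: (@le_trans _ _ (\sum_(0 <= j < n) h' ((i - j) + (j - i))%N)).
  apply: ler_sum_nat => j jn.
  have near : (`|supnorm (a i) - supnorm (a j)|%N <= pdist (a i) (a j))%N.
    by case: (a i) (a j) => x1 x2 [y1 y2]; rewrite /pdist /supnorm /=; lia.
  have [ij|ji|->] := ltngtP i j; last by rewrite subnn; have /andP[] := h01 (pdist (a j) (a j)).
    have := shell_gap jn ij; rewrite (_ : i - j + (j - i) = (j - i - 1).+1)%N; last by lia.
    move=> gap; apply: h_anti; move: near gap; rewrite !ea // (_ : (j - i - 1).+1 = j - i)%N; lia.
  have := shell_gap i_n ji; rewrite (_ : i - j + (j - i) = (i - j - 1).+1)%N; last by lia.
  move=> gap; apply: h_anti; move: near gap; rewrite !ea // (_ : (i - j - 1).+1 = i - j)%N; lia.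
apply: le_trans (sum_dist_le h'0 i_n) _; rewrite ler_wpM2l //.
apply: (@le_trans _ _ (\sum_(0 <= j < n.+1) h' j)).
  by rewrite big_nat_recr //= lerDl.
rewrite big_ltn // lerD2l le_eqVlt; apply/orP; left; apply/eqP.
by apply: eq_big_nat => -[].
Qed.

(** The at most |x| indices j < |x| are given up, each costing at most 1. For the others |a_j| >= j
    >= |x|, so the distance from [x] to [a j] is at most 2 |a_j|, and [h_double] yields the factor
    4. *)
Lemma shell_potential_ge (h : nat -> R) (a : nat -> pt) x :
  (forall r, 0 <= h r <= 1) -> (forall r s, (r <= s)%N -> h s <= h r) ->
  (forall r, h r <= 4 * h r.*2) ->
  (forall j, (j < n)%N -> supnorm (a j) = e j.+1) ->
  \sum_(1 <= j < n.+1) h (e j) - (supnorm x)%:R <=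
    4 * \sum_(0 <= j < n) h (pdist x (a j)).
Proof.
move=> h01 h_anti h_double ea.
have count (m : nat) : \sum_(0 <= j < m) (j < supnorm x)%N%:R <= (supnorm x)%:R :> R.
  have -> : \sum_(0 <= j < m) (j < supnorm x)%N%:R = (minn m (supnorm x))%:R :> R.
    elim: m => [|m IH]; first by rewrite big_geq // min0n.
    by rewrite big_nat_recr //= IH -natrD; congr (_%:R); lia.
  by rewrite ler_nat geq_minr.
rewrite lerBlDr.
apply: (@le_trans _ _ (4 * \sum_(0 <= j < n) h (pdist x (a j)) +
    \sum_(0 <= j < n) (j < supnorm x)%N%:R)); last by rewrite lerD2l.
rewrite mulr_sumr -big_split big_add1 /=; apply: ler_sum_nat => j jn.
have near : (pdist x (a j) <= supnorm (a j) + supnorm x)%N.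
  case: (a j) => x1 x2; case: x {count} => y1 y2.
  by rewrite /pdist /supnorm /=; lia.
have /andP[d0 _] := h01 (pdist x (a j)).
have [jx|xj] := ltnP j (supnorm x).
  by have /andP[_ ?] := h01 (e j.+1); rewrite -[leLHS]add0r lerD // mulr_ge0.
rewrite addr0; apply: le_trans (h_double _) _; rewrite ler_wpM2l //.
apply: h_anti; apply: leq_trans near _; rewrite ea //.
by have := index_le_shell jn; lia.
Qed.
End Superlinear.

Theorem theorem3p2 (R : realType) (alpha : R) (A : set pt) :
  1 <= alpha -> alpha < 2 ->
  superlinear A ->
  (stable_massive alpha A <->
   (\esum_(a in A `\` [set ((0%R : int), (0%R : int))]) (((supnorm a)%:R `^ (2 - alpha))^-1)%:E)%E
     = +oo%E).
Proof.
move=> a1 a2 [[N A_bounded] [L [e [[e_mono e_norms] e_superadd]]]].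
split=> [mA|sum_oo].
  apply: contrapT => sum_fin; apply: (not_massive_of_green a1 a2 _ mA) => x.
  by apply: esum_powR_finite => //; rewrite ltey; apply/eqP.
have a_ge : 2^-1 <= alpha / 2 by rewrite ler_pdivlMr // mulVf.
have a_lt : alpha / 2 < 1 by rewrite ltr_pdivrMr // mul1r.
have a_gt0 : 0 < alpha / 2 by apply: lt_le_trans a_ge; rewrite invr_gt0.
pose h r := green_coef (alpha / 2) (r ^ 2).
pose C := 9 / (alpha / 2) + (1 - alpha / 2)^-1.
have C_gt0 : 0 < C.
  by apply: addr_gt0; [exact: divr_gt0|rewrite invr_gt0 subr_gt0].
have h01 r : 0 <= h r <= 1.
  by rewrite ltW ?green_coef_gt0 //= green_coef_le1 // ltW.
have h_anti r s : (r <= s)%N -> h s <= h r.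
  by move=> rs; apply: green_coef_anti => //; [exact: ltW|rewrite leq_exp2r].
have p_sto := stable_kernel_stochastic a1 a2.
have p_ge0 := stable_kernel_ge0 a1 a2.
have [K K_gt0 green_geK] : exists2 K : R, 0 < K & forall x y,
    ((h (pdist x y) / K)%:E <= green alpha x y)%E.
  by exists 1152; [rewrite ltr0n|exact: green_ge].
(* The potential is at least (1 + s) / (8 K) at [x] and at most 2 C (1 + s) at the chosen points;
   the ratio does not depend on s, hence not on [x]. *)
pose delta := (16 * K * C)^-1.
have delta_gt0 : 0 < delta by rewrite invr_gt0 !mulr_gt0.
have lower x : (delta%:E <= hit_prob (stable_kernel alpha) A x)%E.
  (* The threshold 2 |x| + 1 makes s - |x| at least (1 + s) / 2, which absorbs the loss in
     [shell_potential_ge]. *)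
  have [n n_ok] := @shell_sum_unbounded _ A L e N e_norms A_bounded h _ 2 (ler0n R 2)
     (fun r => proj1 (andP (h01 r))) (fun y y0 => proj2 (andP (green_coef_sq_powR a1 a2 y0)))
     sum_oo (2 * (supnorm x)%:R + 1).
  set s := \sum_(1 <= j < n.+1) _ => s_gt.
  have [a ha] := shell_points e_norms n_ok.
  have ea j : (j < n)%N -> supnorm (a j) = e j.+1 by case/ha.
  pose M := C * (2 * (1 + s)).
  have X0 : 0 <= (supnorm x)%:R :> R by exact: ler0n.
  have s0 : 0 < s by lra.
  have M0 : 0 < M by rewrite mulr_gt0 //; lra.
  have := @green_sum_le_hit_prob _ alpha a1 a2 _ (index_iota 0 n) a A M x.
  have -> : (delta%:E <= hit_prob (stable_kernel alpha) A x)%E =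
     ((M * delta)%:E <= M%:E * hit_prob (stable_kernel alpha) A x)%E.
    by rewrite EFinM lee_pmul2l.
  move=> H; apply: le_trans (H _ _ (ltW M0)).
  - apply: (@le_trans _ _ (\sum_(0 <= j < n) (h (pdist x (a j)) / K)%:E)%E).
      rewrite sumEFin lee_fin -mulr_suml.
      have := shell_potential_ge (h := h) e_mono n_ok x h01 h_anti (green_coef_sq_double a1 a2) ea.
      rewrite -/s; set t := \sum_(0 <= j < n) _ => t_ge.
      have -> : M * delta = (1 + s) / 8 / K.
        by rewrite /M /delta; field; rewrite !gt_eqF.
      rewrite ler_wpM2r ?invr_ge0 ?(ltW K_gt0) //; lra.
    by apply: lee_sum => j _; exact: green_geK.
  - by move=> j; rewrite mem_index_iota => /ha[].
  move=> i; rewrite mem_index_iota => i_n.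
  apply: (@le_trans _ _ (\sum_(0 <= j < n) (C * h (pdist (a i) (a j)))%:E)%E).
    by apply: lee_sum => j _; exact: green_le.
  rewrite sumEFin lee_fin -mulr_sumr ler_wpM2l ?(ltW C_gt0) //.
  exact: (shell_potential_le (h := h) e_superadd n_ok h01 h_anti ea i_n).
apply: (massive_of_lower_bound p_ge0 p_sto delta_gt0 _ lower).
(* That delta <= 1 is read off from delta being a lower bound for a probability. *)
rewrite -lee_fin; apply: le_trans (lower (0, 0)) _.
exact: hit_prob_le1.
Qed.
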